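(* Fix integers $0\le\nu\le p$ and a point $x\in(0,1)$. In the model with equidistant design, with the local polynomial estimator $\hat m_\nu(x)$ of order $p$ and the matrices $\mathbf S,\mathbf S^\ast,\mathbf A_1,\mathbf A_2,\mathbf A_3$ described in the context, assume: (A1) The kernel $K$ is a Lipschitz-continuous, symmetric density function with support $[-1,1]$. (A2) The bandwidth $h=h(\nu,n,N)>0$ satisfies $h\to0$, $Nh^2\to\infty$ and $nh^{2\nu}\to\infty$ as $n,N\to\infty$. (A3) The regression function $m$ has $p+2$ continuous derivatives on $[0,1]$. (A4) The sampling density is $f\equiv1$ on $[0,1]$. (A5) The covariance function $\rho$ is continuous on $[0,1]^2$ and has continuous first-order partial derivatives off the main diagonal; these derivatives have left and right limits on the main diagonal determined by $\rho^{(0,1)}(x,x^-)=\lim_{y\nearrow x}\rho^{(0,1)}(x,y)$ and $\rho^{(0,1)}(x,x^+)=\lim_{y\searrow x}\rho^{(0,1)}(x,y)$. Then: (i) Case $\nu$ even. If moreover $\rho$ is twice continuously differentiable at $(x,x)$ and $Nh^3\to\infty$ as $n,N\to\infty$, then $$\mathrm{Var}(\hat m_\nu(x))=\frac{(\nu!)^2\rho(x,x)}{nh^{2\nu}}\,\mathbf e_\nu'\mathbf S^{-1}\mathbf S^\ast\mathbf S^{-1}\mathbf e_\nu+\frac{(\nu!)^2\rho^{(0,2)}(x,x)}{nh^{2\nu-2}}\,\mathbf e_\nu'\mathbf S^{-1}\mathbf A_1\mathbf S^{-1}\mathbf e_\nu+o\!\left(\frac1{nh^{2\nu-2}}\right).$$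 (ii) Case $\nu$ odd. If moreover $\rho$ is four times continuously differentiable at $(x,x)$ and $Nh^5\to\infty$ as $n,N\to\infty$, then $$\mathrm{Var}(\hat m_\nu(x))=\frac{(\nu!)^2\rho^{(1,1)}(x,x)}{nh^{2\nu-2}}\,\mathbf e_\nu'\mathbf S^{-1}\mathbf A_2\mathbf S^{-1}\mathbf e_\nu+\frac{(\nu!)^2\rho^{(1,3)}(x,x)}{nh^{2\nu-4}}\,\mathbf e_\nu'\mathbf S^{-1}\mathbf A_3\mathbf S^{-1}\mathbf e_\nu+o\!\left(\frac1{nh^{2\nu-4}}\right).$$
   Context: Model. One observes $Y_i(x_j)=m(x_j)+\varepsilon_i(x_j)$, $i=1,\dots,n$, $j=1,\dots,N$, where $m:[0,1]\to\mathbb R$ is a (non-random) regression function and $\varepsilon_1,\dots,\varepsilon_n$ are i.i.d. stochastic processes on $[0,1]$ with mean zero and covariance function $\rho(y,z)=\mathbb E[\varepsilon_i(y)\varepsilon_i(z)]$. The design points $x_j=x_{j,N}$ are determined by a continuous positive probability density $f$ on $[0,1]$ through $\int_0^{x_j}f(t)\,dt=\frac{j-1}{N-1}$, $j=1,\dots,N$; for $f\equiv1$ this is the equidistant design $x_j=\frac{j-1}{N-1}$. Estimator. Let $\bar Y_{\cdot j}=\frac1n\sum_{i=1}^nY_i(x_j)$. Given a bandwidth $h>0$ and a kernel $K$, let $\hat{\boldsymbol\beta}(x)=(\hat\beta_0(x),\dots,\hat\beta_p(x))$ be the solution of $\min_{\beta_0,\dots,\beta_p}\sum_{j=1}^N\left(\bar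 Y_{\cdot j}-\sum_{k=0}^p\beta_k(x_j-x)^k\right)^2\frac1hK\left(\frac{x_j-x}{h}\right)$. The local polynomial estimator of order $p$ of $m^{(\nu)}(x)$ is $\hat m_\nu(x)=\nu!\,\hat\beta_\nu(x)$. Notation. $\rho^{(a,b)}$ denotes the partial derivative of order $a$ in the first and $b$ in the second variable. $\mu_k=\int_{-1}^1u^kK(u)\,du$. With indices $k,l=0,\dots,p$, define the $(p+1)\times(p+1)$ matrices $\mathbf S=(\mu_{k+l})$, $\mathbf S^\ast=(\mu_k\mu_l)$, $\mathbf A_1=\left(\frac12(\mu_k\mu_{l+2}+\mu_{k+2}\mu_l)\right)$, $\mathbf A_2=(\mu_{k+1}\mu_{l+1})$, $\mathbf A_3=\left(\frac16(\mu_{k+3}\mu_{l+1}+\mu_{k+1}\mu_{l+3})\right)$. $(\mathbf e_k)_{k=0,\dots,p}$ is the canonical basis of $\mathbb R^{p+1}$ ($\mathbf e_k$ has a 1 in position $k+1$). A prime on a vector or matrix denotes transpose. *)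

(* Defs.v *)
From HB Require Import structures.
From mathcomp Require Export all_boot all_order all_algebra.
From mathcomp Require Export all_classical all_reals all_analysis.

Set Implicit Arguments.
Unset Strict Implicit.
Unset Printing Implicit Defensive.

Export Order.TTheory GRing.Theory Num.Theory.
Export numFieldNormedType.Exports.

Local Open Scope ring_scope.
Local Open Scope classical_set_scope.

Section processes.
Context d (T : measurableType d) (R : realType) (P : probability T R).

(* The product sigma-algebra on paths indexed by [0, 1]. Paths are encoded as
   total functions R -> R, but only their values on [0, 1] are observed. *)
Definition path_events : set (set (R -> R)) :=
  <<s [set C | exists2 t, 0 <= t <= 1 &
         exists2 B : set R, measurable B & C = [set g | B (g t)]] >>.

Definition path_event (X : R -> {RV P >-> R}) (C : set (R -> R)) : set T :=
  [set w | C (fun t => X t w)].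

Definition identically_distributed (X : nat -> R -> {RV P >-> R}) : Prop :=
  forall i j C, path_events C -> P (path_event (X i) C) = P (path_event (X j) C).

Definition mutually_independent (X : nat -> R -> {RV P >-> R}) : Prop :=
  forall (s : seq nat) (C : nat -> set (R -> R)), uniq s ->
    (forall i, path_events (C i)) ->
    P (\bigcap_(i in [set` s]) path_event (X i) (C i)) =
    (\prod_(i <- s) P (path_event (X i) (C i)))%E.

(* The covariance equation takes real values, so it entails that the second
   moments are finite. *)
Definition iid_errors (eps : nat -> R -> {RV P >-> R}) (rho : R -> R -> R) :
    Prop :=
  [/\ identically_distributed eps,
      mutually_independent eps,
      forall i t, 0 <= t <= 1 -> ('E_P[eps i t] = 0)%E
    & forall i y z, 0 <= y <= 1 -> 0 <= z <= 1 ->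
        ('E_P[eps i y \* eps i z] = (rho y z)%:E)%E].

End processes.

Section differentiability.
Context {R : realType}.
Implicit Types (A : set R) (g : R -> R -> R).

(* Derivative relative to A: one-sided at the end points of an interval. *)
Definition derivative_within A (f : R -> R) (t l : R) : Prop :=
  (f s - f t) / (s - t) @[s --> within (A `\ t) (nbhs t)] --> l.

Definition continuously_derivable_on A (k : nat) (f : R -> R) : Prop :=
  exists D : nat -> R -> R,
    [/\ forall t, A t -> D 0%N t = f t,
        forall i, (i <= k)%N -> {within A, continuous (D i)}
      & forall i t, (i < k)%N -> A t ->
          derivative_within A (D i) t (D i.+1 t)].

(* pderiv a b g is the partial derivative g^{(a,b)}. *)
Definition pderiv (a b : nat) g : R -> R -> R :=
  fun y z => (fun s => (g s)^`(b) z)^`(a) y.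

(* All iterated partial derivatives of order at most k, taken in any order,
   exist near w and are continuous at w. *)
Fixpoint continuously_derivable_at (k : nat) g (w : R * R) : Prop :=
  {for w, continuous (fun v : R * R => g v.1 v.2)} /\
  if k is k'.+1 then
    [/\ \forall v \near w,
          derivable (fun s => g s v.2) v.1 1 /\ derivable (g v.1) v.2 1,
        continuously_derivable_at k' (pderiv 1 0 g) w
      & continuously_derivable_at k' (pderiv 0 1 g) w]
  else True.

End differentiability.

Section estimator.
Context {R : realType}.

Definition sampling_density (f : R -> R) : Prop :=
  [/\ {within `[0, 1], continuous f},
      forall t, 0 <= t <= 1 -> 0 < f t
    & \int[lebesgue_measure]_(t in `[0, 1]) f t = 1].

(* Ordinals start at 0: the point with index j is the (j+1)-st design point. *)
Definition design_points (f : R -> R) (N : nat) (X : 'I_N -> R) : Prop :=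
  forall j : 'I_N, 0 <= X j <= 1 /\
    \int[lebesgue_measure]_(t in `[0, X j]) f t = j%:R / (N%:R - 1).

Definition observation (m e : R -> R) (t : R) : R := m t + e t.

Definition mean_observation (n N : nat) (X : 'I_N -> R) (m : R -> R)
    (e : nat -> R -> R) (j : 'I_N) : R :=
  n%:R^-1 * \sum_(i < n) observation m (e i) (X j).

Definition weighted_residual (p N : nat) (K : R -> R) (h x : R)
    (X y : 'I_N -> R) (beta : 'cV[R]_p.+1) : R :=
  \sum_(j < N) (y j - \sum_(k < p.+1) beta k 0 * (X j - x) ^+ k) ^+ 2
                * (h^-1 * K ((X j - x) / h)).

(* The minimizer is unique as soon as the window around x contains enough
   design points; otherwise an arbitrary one is selected. *)
Definition local_poly_coef (p N : nat) (K : R -> R) (h x : R)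
    (X y : 'I_N -> R) : 'cV[R]_p.+1 :=
  xget 0 [set beta : 'cV[R]_p.+1 | forall gamma : 'cV[R]_p.+1,
    weighted_residual K h x X y beta <= weighted_residual K h x X y gamma].

Definition local_poly_estimator (p : nat) (nu : 'I_p.+1) (N : nat) (K : R -> R)
    (h x : R) (X y : 'I_N -> R) : R :=
  nu`!%:R * local_poly_coef p K h x X y nu 0.

End estimator.

Section moment_matrices.
Context {R : realType} (p : nat) (K : R -> R).

Definition kernel_moment (k : nat) : R :=
  \int[lebesgue_measure]_(u in `[-1, 1]) (u ^+ k * K u).

Local Notation mu := kernel_moment.

Definition mxS : 'M[R]_p.+1 := \matrix_(k, l) mu (k + l).
Definition mxSstar : 'M[R]_p.+1 := \matrix_(k, l) (mu k * mu l).
Definition mxA1 : 'M[R]_p.+1 :=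
  \matrix_(k, l) (2^-1 * (mu k * mu (l + 2) + mu (k + 2) * mu l)).
Definition mxA2 : 'M[R]_p.+1 := \matrix_(k, l) (mu (k + 1) * mu (l + 1)).
Definition mxA3 : 'M[R]_p.+1 :=
  \matrix_(k, l) (6^-1 * (mu (k + 3) * mu (l + 1) + mu (k + 1) * mu (l + 3))).

Definition basis_vector (nu : 'I_p.+1) : 'cV[R]_p.+1 := delta_mx nu 0.

(* e_nu' S^-1 A S^-1 e_nu *)
Definition sandwich (A : 'M[R]_p.+1) (nu : 'I_p.+1) : R :=
  ((basis_vector nu)^T *m invmx mxS *m A *m invmx mxS *m basis_vector nu) 0 0.

End moment_matrices.

Section assumptions.
Context {R : realType}.

Definition kernel_assumption (K : R -> R) : Prop :=
  [/\ [lipschitz K u | u in [set: R]],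
      forall u, K (- u) = K u,
      forall u, 0 <= K u,
      (\int[lebesgue_measure]_u (K u)%:E = 1)%E
    & closure [set u | K u != 0] = `[-1, 1]].

(* "n, N -> oo" is the joint limit: both indices tend to infinity, without any
   relation between them. *)
Definition joint_oo : set_system (nat * nat) := filter_prod \oo \oo.

Definition bandwidth_assumption (nu : nat) (h : nat -> nat -> R) : Prop :=
  [/\ forall n N, 0 < h n N,
      h z.1 z.2 @[z --> joint_oo] --> 0,
      z.2%:R * h z.1 z.2 ^+ 2 @[z --> joint_oo] --> +oo
    & z.1%:R * h z.1 z.2 ^+ (2 * nu) @[z --> joint_oo] --> +oo].

(* The limits on the diagonal are stated for rho^{(0,1)}; those of rho^{(1,0)}
   follow because a covariance function is symmetric. *)
Definition covariance_assumption (rho : R -> R -> R) : Prop :=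
  {within `[0, 1]%classic `*` `[0, 1]%classic,
    continuous (fun v : R * R => rho v.1 v.2)} /\
  let off_diagonal := [set v : R * R | [/\ 0 <= v.1 <= 1, 0 <= v.2 <= 1
                                          & v.1 != v.2]] in
  exists rho10 rho01 : R -> R -> R,
    [/\ forall y z, off_diagonal (y, z) ->
          derivative_within `[0, 1] (rho ^~ z) y (rho10 y z) /\
          derivative_within `[0, 1] (rho y) z (rho01 y z),
        {within off_diagonal, continuous (fun v : R * R => rho10 v.1 v.2)},
        {within off_diagonal, continuous (fun v : R * R => rho01 v.1 v.2)},
        forall t, 0 < t <= 1 -> cvg (rho01 t y @[y --> t^'-])
      & forall t, 0 <= t < 1 -> cvg (rho01 t y @[y --> t^'+])].

End assumptions.

(* Main.v *)
Require Import Defs.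
From HB Require Import structures.
From mathcomp Require Import ring lra measurable_realfun.

(* With u_j = (x_j - x) / h, the estimator is the linear form
   nu! h^-nu (N h)^-1 sum_j phi_j Ybar_j with phi_j = K(u_j) sum_k w_k u_j^k, where w is the
   row nu of the inverse of the matrix of the empirical moments
   m_k = (N h)^-1 sum_j u_j^k K(u_j).  Hence
     Var = nu!^2 / (n h^(2 nu)) * (N h)^-2 sum_(j, k) phi_j phi_k rho(x_j, x_k).
   Replacing rho by its Taylor polynomial of order q (2 or 4) at (x, x) before taking the
   limit turns the double sum into products of one-dimensional sums, so that only the
   Riemann sums m_k = mu_k + O(1 / (N h)) = mu_k + o(h^q) are needed.  The limits of
   (N h)^-1 sum_j phi_j u_j^a vanish when a + nu is odd, because the odd moments of K do, and
   the symmetry of rho identifies the two remaining Taylor coefficients of order q. *)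

Set Implicit Arguments.
Unset Strict Implicit.
Unset Printing Implicit Defensive.
Local Open Scope ring_scope.
Local Open Scope classical_set_scope.

(** * Variance of weighted sums of the errors *)

(** Besides the factor n^-1 h^(-2 nu), the error must be o(h^q) even in the Taylor terms that carry
    few powers of h. Plain convergence of the moments would therefore not suffice: every limit is
    carried with the rate h^q, and this rate has to survive the inversion of the moment matrix. The
    hypotheses N h^3 -> oo and N h^5 -> oo say exactly that the Riemann error 1 / (N h) is o(h^q).
    Exchanging the two variables of rho also reverses the order in which mixed derivatives are
    taken. The equality of the coefficients of s t^3 and s^3 t is therefore read off from the Taylor
    polynomial, as an instance of the uniqueness of such expansions, and no theorem on the exchange
    of derivatives is involved. *)

Section expectation_independent.
Context d (T : measurableType d) (R : realType) (P : probability T R).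
Local Open Scope ereal_scope.

Lemma Lfun2_expectation_sqr (X : {RV P >-> R}) :
  'E_P[X \* X] < +oo -> (X : T -> R) \in Lfun P 2%:E.
Proof.
move=> X2; rewrite inE; apply/andP; split; rewrite inE//=.
rewrite /finite_norm unlock /Lnorm poweR_lty//.
move: X2; rewrite unlock; apply: le_lt_trans; rewrite le_eqVlt; apply/orP; left.
apply/eqP/eq_integral => w _ /=.
by rewrite powR_mulrn// real_normK ?num_real// expr2.
Qed.

(** Rectangles determine a product measure, so independence identifies the law of (X, Y) with the
    product of the marginal laws; Fubini then factors the integral of z.1 * z.2. *)
Lemma expectationM_independent (X Y : {RV P >-> R}) :
  (forall A B, measurable A -> measurable B ->
     P (X @^-1` A `&` Y @^-1` B) = P (X @^-1` A) * P (Y @^-1` B)) ->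
  (X : T -> R) \in Lfun P 1 -> (Y : T -> R) \in Lfun P 1 ->
  (X \* Y)%R \in Lfun P 1 ->
  'E_P[X \* Y] = 'E_P[X] * 'E_P[Y].
Proof.
move=> XY /Lfun1_integrable iX /Lfun1_integrable iY /Lfun1_integrable iXY.
pose Z (w : T) : (R * R)%type := (X w, Y w).
have mZ : measurable_fun setT Z by apply: measurable_fun_pair.
pose f (z : (R * R)%type) : \bar R := (z.1 * z.2)%:E.
have mf : measurable_fun [set: (R * R)%type] f.
  by apply/measurable_EFinP; apply: measurable_funM;
    [exact: measurable_fst|exact: measurable_snd].
pose PX := distribution P X; pose PY := distribution P Y.
pose ZZ : {mfun T >-> (R * R)%type} :=
  HB.pack Z (isMeasurableFun.Build _ _ _ _ Z mZ).
have PZ A : measurable A -> (PX \x PY) A = distribution P ZZ A.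
  apply: product_measure_unique => B C mB mC /=.
  by rewrite -XY//; congr (P _); apply/seteqP; split => w /=.
have iZ : (distribution P ZZ).-integrable [set: (R * R)%type] f.
  by apply: (integrable_pushforward mZ).
have iprod : (PX \x PY).-integrable [set: (R * R)%type] f.
  have /integrableP[_ ilt] := iZ; apply/integrableP; split => //.
  rewrite (eq_measure_integral (distribution P ZZ))//.
  by move=> A mA _; exact: PZ.
rewrite unlock -(integral_distribution (X := ZZ) mf iXY).
rewrite (eq_measure_integral (PX \x PY)); last by move=> A mA _; rewrite [RHS]PZ.
rewrite -(integral12_prod_meas1 iprod) /fubini_F /f.
have iYE : \int[PY]_y y%:E = \int[P]_w (Y w)%:E.
  exact: (integral_distribution (f := EFin)).
have iXE : \int[PX]_y y%:E = \int[P]_w (X w)%:E.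
  exact: (integral_distribution (f := EFin)).
have finY : \int[P]_w (Y w)%:E \is a fin_num by exact: integrable_fin_num.
under eq_integral => u _.
  under eq_integral do rewrite /= EFinM.
  rewrite integralZl//=; last by apply: (integrable_pushforward (phi := Y)).
  rewrite iYE; over.
rewrite -iXE; rewrite -(fineK finY) integralZr//.
by apply: (integrable_pushforward (phi := X)).
Qed.

End expectation_independent.

Section covariance_sum.
Context d (T : measurableType d) (R : realType) (P : probability T R).
Local Open Scope ereal_scope.

Lemma Lfun2_sum (I : Type) (r : seq I) (F : I -> T -> R) :
  (forall i, F i \in Lfun P 2%:E) ->
  (fun w => \sum_(i <- r) F i w)%R \in Lfun P 2%:E.
Proof.
have [Lf0 LfD] := Lfun_addr_closed P (lee1n 2 : (1 <= 2%:E :> \bar R)).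
move=> F2; elim: r => [|i r IH].
  by rewrite (_ : (fun _ => _) = 0%R)//; apply/funext => w; rewrite big_nil.
rewrite (_ : (fun _ => _) = F i + fun w => \sum_(j <- r) F j w)%R ?LfD//.
by apply/funext => w; rewrite big_cons.
Qed.

Lemma covariance_suml (I : Type) (r : seq I) (F : I -> T -> R) (Y : T -> R) :
  (forall i, F i \in Lfun P 2%:E) -> Y \in Lfun P 2%:E ->
  covariance P (fun w => \sum_(i <- r) F i w)%R Y =
  \sum_(i <- r) covariance P (F i) Y.
Proof.
move=> F2 Y2; elim: r => [|i r IH].
  rewrite big_nil -[RHS](covariance_cst_l P 0 Y); congr covariance.
  by apply/funext => w; rewrite big_nil.
rewrite big_cons -IH -covarianceDl// ?Lfun2_sum//; congr covariance.
by apply/funext => w /=; rewrite big_cons.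
Qed.

Lemma covariance_sumr (I : Type) (r : seq I) (F : I -> T -> R) (Y : T -> R) :
  (forall i, F i \in Lfun P 2%:E) -> Y \in Lfun P 2%:E ->
  covariance P Y (fun w => \sum_(i <- r) F i w)%R =
  \sum_(i <- r) covariance P Y (F i).
Proof.
move=> F2 Y2; rewrite covarianceC covariance_suml//.
by apply: eq_bigr => i _; rewrite covarianceC.
Qed.

End covariance_sum.

Section iid_errors.
Context d (T : measurableType d) (R : realType) (P : probability T R).
Variables (eps : nat -> R -> {RV P >-> R}) (rho : R -> R -> R).
Hypothesis errors : iid_errors eps rho.
Local Open Scope ereal_scope.

Lemma iid_errors_Lfun2 i t : (0 <= t <= 1)%R -> (eps i t : T -> R) \in Lfun P 2%:E.
Proof.
by case: errors => _ _ _ E2 t01; rewrite Lfun2_expectation_sqr// E2// ltry.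
Qed.

Lemma iid_errors_independent i j y z A B : i != j -> (0 <= y <= 1)%R -> (0 <= z <= 1)%R ->
  measurable A -> measurable B ->
  P (eps i y @^-1` A `&` eps j z @^-1` B) = P (eps i y @^-1` A) * P (eps j z @^-1` B).
Proof.
case: errors => _ ind _ _ ij y01 z01 mA mB.
(* Independence is stated for whole paths; events on single values are cylinders at the times y and
   z. *)
pose C k : set (R -> R) := if k == i then [set g | A (g y)] else [set g | B (g z)].
have Ci : C i = [set g | A (g y)] by rewrite /C eqxx.
have Cj : C j = [set g | B (g z)] by rewrite /C eq_sym (negbTE ij).
have := ind [:: i; j] C.
rewrite big_cons big_seq1 Ci Cj => <- /=.
- congr (P _); apply/seteqP; split => w /=.
    by move=> [Aw Bw] k /=; rewrite !inE => /orP[]/eqP ->; rewrite ?Ci ?Cj.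
  move=> Cw; split.
    by have := Cw i; rewrite Ci; apply; rewrite /= !inE eqxx.
  by have := Cw j; rewrite Cj; apply; rewrite /= !inE eqxx orbT.
- by rewrite inE ij.
- move=> k; apply: sub_sigma_algebra; rewrite /C; case: ifP => _.
    by exists y => //; exists A.
by exists z => //; exists B.
Qed.

Lemma iid_errors_covariance i j y z : (0 <= y <= 1)%R -> (0 <= z <= 1)%R ->
  covariance P (eps i y) (eps j z) = ((i == j)%:R * rho y z)%:E.
Proof.
move=> y01 z01.
have y2 := iid_errors_Lfun2 i y01; have z2 := iid_errors_Lfun2 j z01.
have Pfin : P setT \is a fin_num := fin_num_measure P _ measurableT.
have yz1 := Lfun2_mul_Lfun1 y2 z2.
have y1 := Lfun_subset12 Pfin y2.
have z1 := Lfun_subset12 Pfin z2.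
case: errors => _ _ E0 E2; rewrite covarianceE// !E0// mule0 sube0.
have [<-|ij] := eqVneq i j; first by rewrite mul1r E2.
rewrite mul0r expectationM_independent ?E0 ?mule0//.
by move=> A B mA mB; exact: iid_errors_independent.
Qed.

(** The constant [c] is meant for the contribution of m. Errors with distinct indices i are
    uncorrelated, so the double sum over pairs (design point, replicate) reduces to n equal blocks
    weighted by n^-2. *)
Lemma variance_weighted_errors (N n : nat) (X b : 'I_N -> R) (c : R) :
  (0 < n)%N -> (forall j, 0 <= X j <= 1)%R ->
  'V_P[fun w => (c + \sum_(j < N) b j * (n%:R^-1 * \sum_(i < n) eps i (X j) w))%R]
  = (n%:R^-1 * \sum_(j < N) \sum_(k < N) b j * b k * rho (X j) (X k))%:E.
Proof.
move=> n0 X01.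
pose F (q : 'I_N * 'I_n) (w : T) : R := (eps q.2 (X q.1) w * (b q.1 * n%:R^-1))%R.
have F2 q : F q \in Lfun P 2%:E by apply: Lfun_scale; rewrite ?ler1n// iid_errors_Lfun2.
have -> : (fun w => (c + \sum_(j < N) b j * (n%:R^-1 * \sum_(i < n) eps i (X j) w))%R)
   = (cst c \+ fun w => \sum_q F q w)%R.
  apply/funext => w /=; congr (_ + _)%R.
  under eq_bigr do rewrite mulrA mulr_sumr.
  by rewrite pair_bigA /=; apply: eq_bigr => q _; rewrite mulrC.
rewrite varianceD_cst_l ?Lfun2_sum//.
rewrite /variance covariance_suml ?Lfun2_sum//.
have covF q q' : covariance P (F q) (F q') =
    ((q.2 == q'.2)%:R * (n%:R^-1 ^+ 2 * (b q.1 * b q'.1 * rho (X q.1) (X q'.1))))%:E.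
  have L2 i j := iid_errors_Lfun2 i (X01 j).
  have L1 i j := Lfun_subset12 (fin_num_measure P _ measurableT) (L2 i j).
  rewrite covarianceZl//; last 2 first.
    by apply: Lfun_scale.
    by apply: Lfun2_mul_Lfun1 => //; apply: Lfun_scale; rewrite ?ler1n.
  rewrite covarianceZr//; last by apply: Lfun2_mul_Lfun1.
  rewrite iid_errors_covariance// -!EFinM; congr EFin.
  by rewrite -val_eqE; ring.
under eq_bigr => q _.
  rewrite covariance_sumr//; under eq_bigr do rewrite covF.
  rewrite sumEFin; over.
rewrite sumEFin; congr EFin.
rewrite mulr_sumr -(pair_bigA _ (fun j i => \sum_q' ((i == q'.2)%:R *
  (n%:R^-1 ^+ 2 * (b j * b q'.1 * rho (X j) (X q'.1)))))%R) /=.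
apply: eq_bigr => j _.
under eq_bigr => i _.
  rewrite -(pair_bigA _ (fun k i' => ((i == i')%:R *
    (n%:R^-1 ^+ 2 * (b j * b k * rho (X j) (X k)))))%R) /=.
  under eq_bigr => k _.
    rewrite -mulr_suml (bigD1 i)//= eqxx big1 ?addr0 ?mul1r; last first.
      by move=> i' /negbTE; rewrite eq_sym => ->.
    over.
  rewrite -mulr_sumr; over.
rewrite sumr_const card_ord -mulrnAl; congr (_ * _)%R.
by rewrite expr2 -mulr_natl mulrA divff ?mul1r// pnatr_eq0 -lt0n.
Qed.

End iid_errors.

(** * The weighted least squares problem *)

Section local_polynomial.
Context {R : realType} (p N : nat) (K : R -> R) (h x : R) (X : 'I_N -> R).

Definition rescaled (j : 'I_N) : R := (X j - x) / h.

Definition empirical_moment (k : nat) : R :=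
  (N%:R * h)^-1 * \sum_(j < N) rescaled j ^+ k * K (rescaled j).

Definition empirical_mx : 'M[R]_p.+1 := \matrix_(k, l) empirical_moment (k + l).

Definition effective_weight (nu : 'I_p.+1) (j : 'I_N) : R :=
  K (rescaled j) * \sum_k invmx empirical_mx nu k * rescaled j ^+ k.

Hypotheses (h_gt0 : 0 < h) (N_gt0 : (0 < N)%N) (K_ge0 : forall u, 0 <= K u).
Hypothesis unit_mx : empirical_mx \in unitmx.

Let Nh_neq0 : N%:R * h != 0.
Proof. by rewrite mulf_neq0 ?gt_eqF// ltr0n. Qed.

Let fit (beta : 'cV[R]_p.+1) (j : 'I_N) : R :=
  \sum_(k < p.+1) beta k 0 * (X j - x) ^+ k.

Let W (j : 'I_N) : R := h^-1 * K (rescaled j).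

Let W_ge0 j : 0 <= W j.
Proof. by rewrite mulr_ge0// invr_ge0 ltW. Qed.

Let fit_rescaled beta j :
  fit beta j = \sum_(k < p.+1) (h ^+ k * beta k 0) * rescaled j ^+ k.
Proof.
apply: eq_bigr => k _; rewrite /rescaled expr_div_n.
have hk : h ^+ k != 0 by rewrite expf_neq0 ?gt_eqF.
by rewrite [h ^+ k * _]mulrC -!mulrA; congr (_ * _); rewrite mulrC mulfVK.
Qed.

(** Source of uniqueness: a fit that vanishes wherever the weight is nonzero has its rescaled
    coefficients in the kernel of [empirical_mx]. *)
Let fit_inj delta : (forall j, W j * fit delta j ^+ 2 = 0) -> delta = 0.
Proof.
move=> W0.
have K0 j : K (rescaled j) * fit delta j = 0.
  apply/eqP; have /eqP := W0 j.
  by rewrite !mulf_eq0 invr_eq0 gt_eqF//= orbb.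
pose g : 'cV[R]_p.+1 := \col_k (h ^+ k * delta k 0).
suff g0 : g = 0.
  apply/colP => k; have /colP/(_ k) := g0; rewrite !mxE => /eqP.
  by rewrite mulf_eq0 expf_eq0 gt_eqF// andbF => /eqP.
have Mg : empirical_mx *m g = 0.
  apply/colP => k; rewrite !mxE.
  under eq_bigr do rewrite !mxE /empirical_moment -mulrA mulr_suml.
  rewrite -mulr_sumr exchange_big big1 ?mulr0// => j _.
  rewrite (eq_bigr (fun l : 'I_p.+1 => (rescaled j ^+ k * K (rescaled j)) *
    ((h ^+ l * delta l 0) * rescaled j ^+ l))); last first.
    by move=> l _; rewrite exprD; ring.
  by rewrite -mulr_sumr -fit_rescaled -mulrA K0 mulr0.
by rewrite -(mulKmx unit_mx g) Mg mulmx0.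
Qed.

(** Pythagoras: the hypothesis is the system of normal equations, which cancels the cross term. *)
Let residualB y beta gamma :
  (forall k : 'I_p.+1, \sum_j W j * (X j - x) ^+ k * (y j - fit beta j) = 0) ->
  weighted_residual K h x X y gamma =
  weighted_residual K h x X y beta + \sum_j W j * fit (gamma - beta) j ^+ 2.
Proof.
move=> ortho; rewrite /weighted_residual.
have cross : \sum_j W j * fit (gamma - beta) j * (y j - fit beta j) = 0.
  under eq_bigr do rewrite /fit mulr_sumr mulr_suml.
  rewrite exchange_big big1// => k _.
  rewrite (eq_bigr (fun j => (gamma - beta) k 0 *
    (W j * (X j - x) ^+ k * (y j - fit beta j)))); last first.
    by move=> j _; rewrite [W j * (_ * _)]mulrCA -!mulrA.
  by rewrite -mulr_sumr ortho mulr0.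
transitivity (\sum_j ((y j - fit beta j) ^+ 2 * W j + W j * fit (gamma - beta) j ^+ 2
   - 2 * (W j * fit (gamma - beta) j * (y j - fit beta j)))).
  apply: eq_bigr => j _; rewrite -/(fit gamma j) -/(W j).
  have -> : fit gamma j = fit beta j + fit (gamma - beta) j.
    rewrite -big_split; apply: eq_bigr => k _ /=.
    by rewrite !mxE -mulrDl [beta k 0 + _]addrC subrK.
  by ring.
by rewrite big_split /= sumrN -mulr_sumr cross mulr0 subr0 big_split.
Qed.

Lemma local_poly_estimatorE (nu : 'I_p.+1) (y : 'I_N -> R) :
  local_poly_estimator nu K h x X y =
  nu`!%:R * (h ^- nu * (N%:R * h)^-1) * \sum_j effective_weight nu j * y j.
Proof.
pose c : 'cV[R]_p.+1 :=
  \col_k ((N%:R * h)^-1 * \sum_j rescaled j ^+ k * K (rescaled j) * y j).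
pose g := invmx empirical_mx *m c.
(* [g] solves the normal equations in the rescaled variable; h^-k returns to powers of X j - x and
   is the source of h^-nu in the estimator. *)
pose beta : 'cV[R]_p.+1 := \col_k (h ^- k * g k 0).
have hk k : h ^+ k != 0 by rewrite expf_neq0 ?gt_eqF.
have fitE j : fit beta j = \sum_(l < p.+1) g l 0 * rescaled j ^+ l.
  by rewrite fit_rescaled; apply: eq_bigr => l _; rewrite mxE mulVKf.
have ortho (k : 'I_p.+1) : \sum_j W j * (X j - x) ^+ k * (y j - fit beta j) = 0.
  have : empirical_mx *m g = c by rewrite mulKVmx.
  move=> /colP/(_ k); rewrite !mxE.
  under eq_bigr => l _ do rewrite mxE /empirical_moment -mulrA mulr_suml.
  rewrite -mulr_sumr exchange_big => /(mulfI (invr_neq0 Nh_neq0)) cE.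
  transitivity (h^-1 * h ^+ k * (\sum_j rescaled j ^+ k * K (rescaled j) * y j
     - \sum_j rescaled j ^+ k * K (rescaled j) * fit beta j)).
    rewrite -sumrB mulr_sumr; apply: eq_bigr => j _.
    have -> : X j - x = h * rescaled j by rewrite /rescaled mulrC divfK ?gt_eqF.
    by rewrite /W exprMn; ring.
  rewrite -cE -sumrB big1 ?mulr0// => j _.
  rewrite fitE mulr_sumr -sumrB big1// => l _.
  by rewrite exprD; ring.
have -> : local_poly_estimator nu K h x X y = nu`!%:R * beta nu 0.
  rewrite /local_poly_estimator; congr (_ * fun_of_matrix _ _ _).
  (* [xget] selects some minimizer, so both minimality and uniqueness of [beta] have to be shown. *)
  apply: xget_unique.
    move=> gamma; rewrite (residualB gamma ortho) lerDl.
    by apply: sumr_ge0 => j _; rewrite mulr_ge0// sqr_ge0.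
  move=> gamma /(_ beta); rewrite (residualB gamma ortho) gerDl => le0.
  apply/eqP; rewrite -subr_eq0; apply/eqP/fit_inj => j.
  have ge0 i : true -> 0 <= W i * fit (gamma - beta) i ^+ 2.
    by rewrite mulr_ge0// sqr_ge0.
  have /eqP : \sum_i W i * fit (gamma - beta) i ^+ 2 = 0.
    by apply/eqP; rewrite eq_le le0 sumr_ge0.
  by rewrite psumr_eq0// => /allP/(_ j); rewrite mem_index_enum => /(_ isT)/eqP.
rewrite -!mulrA; congr (_ * _); rewrite mxE; congr (_ * _).
rewrite mxE mulr_sumr.
under eq_bigr => k _ do rewrite mxE mulrCA mulr_sumr.
rewrite -!mulr_sumr exchange_big; congr (_ * _); apply: eq_bigr => j _.
rewrite /effective_weight mulr_sumr mulr_suml; apply: eq_bigr => k _.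
by ring.
Qed.

End local_polynomial.

(** * Riemann sums and moments of the kernel *)

Section kernel.
Context {R : realType}.
Implicit Types (f g G K : R -> R) (a b t u v L : R).
Local Notation mu := (@lebesgue_measure R).

Lemma mean_value f df a b : a < b ->
  (forall t, a <= t <= b -> is_derive t 1 f (df t)) ->
  exists2 c, a < c < b & f b - f a = df c * (b - a).
Proof.
move=> ab fdf.
have [t tab|t tab|c cab E] := @MVT R f df a b ab.
- by apply: fdf; rewrite !ltW ?(itvP tab).
- apply: derivable_within_continuous => s sab.
  by have := fdf s; rewrite !(itvP sab) => /(_ isT)[].
- by exists c; rewrite ?(itvP cab).
Qed.

(** A global Lipschitz bound alone is lost on multiplication by u; the bounded support keeps the
    class stable. *)
Definition compactly_lipschitz L g : Prop :=
  (forall u v, `|g u - g v| <= L * `|u - v|) /\ (forall u, 1 < `|u| -> g u = 0).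

Lemma lipschitz_continuous L g :
  (forall u v, `|g u - g v| <= L * `|u - v|) -> continuous g.
Proof.
move=> gL u; apply/cvgrPdist_lt => /= e e0; near=> v.
apply: (le_lt_trans (gL _ _)).
have L1 : 0 < `|L| + 1 by rewrite ltr_wpDl.
apply: (@le_lt_trans _ _ ((`|L| + 1) * `|u - v|)).
  by rewrite ler_wpM2r// (le_trans (ler_norm _))// lerDl.
rewrite -ltr_pdivlMl//; near: v.
by apply: cvgr_dist_lt; [exact: cvg_id|rewrite mulr_gt0 ?invr_gt0].
Unshelve. all: by end_near. Qed.

Lemma compactly_lipschitz_mulX L g : 0 <= L -> compactly_lipschitz L g ->
  compactly_lipschitz (L + L * 3) (fun u => u * g u).
Proof.
move=> L0 [gL g0]; split=> [u v|u u1]; last by rewrite g0// mulr0.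
have bound w : `|g w| <= L * 3.
  have [w1|w1] := leP `|w| 1; last by rewrite g0// normr0 mulr_ge0.
  have -> : g w = g w - g 2 by rewrite (g0 2) ?subr0// gtr0_norm// ltr1n.
  rewrite (le_trans (gL _ _))// ler_wpM2l// (le_trans (ler_normB _ _))//.
  by rewrite [`|2|]gtr0_norm//; lra.
have [u1|u1] := leP `|u| 1.
  have -> : u * g u - v * g v = u * (g u - g v) + g v * (u - v) by ring.
  rewrite (le_trans (ler_normD _ _))// !normrM mulrDl lerD ?ler_wpM2r//.
  by rewrite (le_trans _ (gL u v))// ler_piMl.
rewrite (g0 u u1) mulr0 sub0r normrN normrM.
have [v1|v1] := leP `|v| 1; last by rewrite g0// normr0 mulr0 mulr_ge0// addr_ge0// mulr_ge0.
rewrite (le_trans (ler_piMl _ v1))//.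
have -> : `|g v| = `|g u - g v| by rewrite (g0 u u1) sub0r normrN.
by rewrite (le_trans (gL _ _))// ler_wpM2r// lerDl mulr_ge0.
Qed.

(** The primitive is an integral started at a, hence the restriction to u > a; it is applied with a
    to the left of the interval of interest. *)
Lemma ex_primitive g a : continuous g ->
  exists G, forall u, a < u -> is_derive u 1 G (g u).
Proof.
move=> cg; exists (fun u => \int[mu]_(t in `[a, u]) g t) => u au.
have uu1 : u < u + 1 by rewrite ltrDl.
have [||dG E] := @continuous_FTC1_closed R g a u (u + 1) uu1 _ au.
- apply: continuous_compact_integrable; first exact: segment_compact.
  exact: continuous_subspaceT.
- exact: cg.
- by rewrite -E derive1E; exact: derivableP.
Qed.

Lemma integral_primitive g G a b : a < b -> continuous g ->
  (forall t, a <= t <= b -> is_derive t 1 G (g t)) ->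
  \int[mu]_(t in `[a, b]) g t = G b - G a.
Proof.
move=> ab cg GE.
have cG t : a <= t <= b -> {for t, continuous G}.
  by move=> /GE [dG _]; exact/differentiable_continuous/derivable1_diffP.
rewrite /Rintegral (@continuous_FTC2 _ g G)//.
- exact: continuous_subspaceT.
- split=> [t tab||].
  + by have [] := GE t; rewrite ?ltW ?(itvP tab).
  + by apply: cvg_at_right_filter; apply: cG; rewrite lexx ltW.
  + by apply: cvg_at_left_filter; apply: cG; rewrite lexx ltW.
- move=> t tab; rewrite derive1E.
  by have [] := GE t; rewrite ?ltW ?(itvP tab).
Qed.

(* Cells [v_j, v_(j+1)] that miss the support contribute nothing; the increments of the
   truncation [clamp] count the other ones, so the error is of order delta whatever the
   total number of cells. *)
Lemma riemann_sum L g a delta n : 0 <= L -> compactly_lipschitz L g ->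
  0 < delta -> a < -1 -> 1 < a + n%:R * delta ->
  `|delta * \sum_(j < n) g (a + j%:R * delta) - \int[mu]_(u in `[-1, 1]) g u|
    <= L * delta * (2 + 2 * delta).
Proof.
move=> L0 [gL g0] d0 a1 an; have cg := lipschitz_continuous gL.
have [G GE] := @ex_primitive g (a - 1) cg.
pose v j := a + j%:R * delta.
have vS j : v j.+1 = v j + delta by rewrite /v -natr1; ring.
have av j : a <= v j by rewrite lerDl mulr_ge0// ltW.
(* The margin delta makes [clamp] the identity at both ends of every cell that meets [-1, 1]. *)
pose clamp t := Num.max (- (1 + delta)) (Num.min t (1 + delta)).
have mono s t : s <= t -> clamp s <= clamp t.
  move=> st; rewrite /clamp ge_max le_max lexx/= le_max; apply/orP; right.
  by rewrite le_min !ge_min st lexx orbT.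
have -> : \int[mu]_(u in `[-1, 1]) g u = G 1 - G (-1).
  apply: integral_primitive => //.
  by move=> t /andP[t1 _]; apply: GE; lra.
(* G does not change between v 0 and -1 nor between 1 and v n, since g vanishes there. *)
have -> : G 1 - G (-1) = G (v n) - G (v 0%N).
  have v0 : v 0%N = a by rewrite /v mul0r addr0.
  have [|t /andP[t1 _]|c /andP[c1 _] E1] := @mean_value G g 1 (v n).
  - by rewrite /v; lra.
  - by apply: GE; lra.
  have [|t /andP[t1 _]|c' /andP[_ c'1] E2] := @mean_value G g (v 0%N) (-1).
  - by rewrite v0; lra.
  - by apply: GE; rewrite v0 in t1; lra.
  move: E1 E2; rewrite !g0 ?mul0r; last 2 first.
  - by rewrite ltr0_norm; lra.
  - by rewrite gtr0_norm; lra.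
  by lra.
rewrite -(telescope_sumr (fun j => G (v j)) (leq0n n)) big_mkord mulr_sumr -sumrB.
rewrite (le_trans (ler_norm_sum _ _ _))//.
apply: (@le_trans _ _ (\sum_(j < n) L * delta * (clamp (v j.+1) - clamp (v j)))).
  apply: ler_sum => j _; rewrite -/(v j).
  (* The integral over one cell is g c * delta with c in the cell, so the Lipschitz bound gives an
     error of at most L delta^2. *)
  have [|t /andP[t1 _]|c /andP[c1 c2] E] := @mean_value G g (v j) (v j.+1).
  - by rewrite vS ltrDl.
  - by apply: GE; have := av j; lra.
  rewrite E vS [v j + delta - v j]addrAC subrr add0r [g c * _]mulrC -mulrBr.
  rewrite normrM (gtr0_norm d0) [L * _]mulrC -mulrA ler_pM2l//.
  have [out|/andP[in1 in2]] : (v j.+1 < -1) || (1 < v j) \/ (-1 <= v j.+1) && (v j <= 1).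
    by have [] := ltP (v j.+1) (-1); have [] := ltP 1 (v j); auto.
  - have vSj := vS j.
    have vout : 1 < `|v j|.
      by rewrite lter_normr; case/orP: out => o; apply/orP; [right|left]; lra.
    have cout : 1 < `|c|.
      by rewrite lter_normr; case/orP: out => o; apply/orP; [right|left]; lra.
    rewrite !g0//.
    by rewrite subrr normr0 mulr_ge0// subr_ge0 mono//; lra.
  - rewrite vS in in1 c2 *.
    rewrite /clamp !min_l ?max_r; [|lra..].
    rewrite (le_trans (gL _ _))// ler_wpM2l// ltr0_norm; lra.
rewrite -mulr_sumr -(big_mkord xpredT (fun j => clamp (v j.+1) - clamp (v j))).
rewrite telescope_sumr// ler_wpM2l ?mulr_ge0 ?(ltW d0)//.
have : clamp (v n) <= 1 + delta by rewrite /clamp ge_max ge_min lexx orbT andbT; lra.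
have : - (1 + delta) <= clamp (v 0%N) by rewrite /clamp le_max lexx.
by lra.
Qed.

End kernel.

(** * Consequences of the kernel assumption *)

Section kernel.
Context {R : realType}.
Implicit Types (f g G K : R -> R) (a b t u v L : R).

Section kernel_assumption.
Variable K : R -> R.
Hypothesis K_kernel : kernel_assumption K.

Lemma kernel_ge0 u : 0 <= K u. Proof. by case: K_kernel. Qed.

Lemma kernel_lipschitz : exists2 L, 0 <= L & compactly_lipschitz L K.
Proof.
case: K_kernel => /pinfty_ex_gt0 [L L0 KL] _ _ _ Ksupp; exists L; first exact: ltW.
split=> [u v|]; first exact: (KL (u, v)).
move=> u u1; apply: contraTeq u1 => Ku; rewrite -leNgt ler_norml.
have : closure [set u | K u != 0] u by exact: subset_closure.
by rewrite Ksupp /= in_itv.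
Qed.

Lemma kernel_power_lipschitz k :
  exists2 L, 0 <= L & compactly_lipschitz L (fun u => u ^+ k * K u).
Proof.
elim: k => [|k [L L0 gL]].
  have [L L0 KL] := kernel_lipschitz; exists L => //.
  by under eq_fun do rewrite expr0 mul1r.
exists (L + L * 3); first by rewrite addr_ge0// mulr_ge0.
by under eq_fun do rewrite exprS -mulrA; exact: compactly_lipschitz_mulX.
Qed.

Lemma kernel_power_continuous k : continuous (fun u => u ^+ k * K u).
Proof. by have [L _ [/lipschitz_continuous]] := kernel_power_lipschitz k. Qed.

(** The substitution u -> -u, carried out on primitives: by symmetry of K, [F] is a second primitive
    of the same integrand. *)
Lemma kernel_moment_sign k : kernel_moment K k = (-1) ^+ k * kernel_moment K k.
Proof.
have [G GE] := @ex_primitive R _ (-2) (@kernel_power_continuous k).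
have E : kernel_moment K k = G 1 - G (-1).
  apply: integral_primitive => //; first exact: kernel_power_continuous.
  by move=> t /andP[t1 _]; apply: GE; lra.
pose F u := - ((-1) ^+ k * G (- u)).
have EF : kernel_moment K k = F 1 - F (-1).
  apply: integral_primitive => //; first exact: kernel_power_continuous.
  move=> t t1; have dG : is_derive (- t) 1 G ((- t) ^+ k * K (- t)) by apply: GE; lra.
  have dGN := is_derive1_comp dG (is_deriveNid t 1).
  have := is_deriveN (is_deriveZ ((-1) ^+ k) dGN).
  congr (is_derive _ _ _ _); case: K_kernel => _ -> _ _ _.
  rewrite /GRing.scale/= [(- t) ^+ k]exprNn mulrN1 mulrN opprK mulrA mulrA.
  by rewrite -exprMn mulrNN mulr1 expr1n mul1r.
by rewrite {1}EF E /F opprK mulrBr addrC opprK.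
Qed.

Lemma ex_kernel_gt0 : exists u e, 0 < e /\ forall v, u <= v <= u + e -> 0 < K v.
Proof.
have [u Ku] : exists u, K u != 0.
  apply/not_existsP => K0; case: K_kernel => _ _ _ _.
  rewrite (_ : [set u | _] = set0).
    rewrite closure0 => /seteqP[_ /(_ 0)]; apply.
    by rewrite /= in_itv /=; apply/andP; split; lra.
  by apply/seteqP; split=> // u /= Ku; case: (K0 u).
have Kup : 0 < K u by rewrite lt_def Ku kernel_ge0.
have [L L0 [KL _]] := kernel_lipschitz.
(* Over this length K drops by at most L * K u / (L + 1) < K u; the 1 covers the case L = 0. *)
exists u, (K u / (L + 1)); split; first by rewrite divr_gt0// ltr_wpDl.
move=> v /andP[uv ve]; have : `|K u - K v| < K u.
  rewrite (le_lt_trans (KL u v))// distrC ger0_norm ?subr_ge0//.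
  apply: (@le_lt_trans _ _ (L * (K u / (L + 1)))).
    by rewrite ler_wpM2l// lerBlDl.
  by rewrite mulrCA gtr_pMr// ltr_pdivrMr ?mul1r ?ltrDl// ltr_wpDl.
by rewrite ltr_distlC => /andP[]; lra.
Qed.

(* If v S = 0 then the polynomial q with coefficients v satisfies int q^2 K = v S v' = 0,
   so its squared weight has a zero in every interval on which K is positive. *)
Lemma mxS_unit p : mxS p K \in unitmx.
Proof.
rewrite unitmxE unitfE; apply/det0P => -[v v0 vS0].
have /choice[G GE] k := @ex_primitive R _ (-2) (@kernel_power_continuous k).
have muE k : kernel_moment K k = G k 1 - G k (-1).
  apply: integral_primitive => //; first exact: kernel_power_continuous.
  by move=> t /andP[t1 _]; apply: GE; lra.
pose q : {poly R} := \poly_(k < p.+1) v 0 (inord k).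
(* The same combination of the primitives [G] as q^2 K is of the integrands, so that H 1 - H (-1) is
   v S v'. *)
pose H : R -> R := \sum_(k < p.+1) v 0 k \*: \sum_(l < p.+1) v 0 l \*: G (l + k)%N.
have qE t : q.[t] = \sum_(k < p.+1) v 0 k * t ^+ k.
  by rewrite horner_poly; apply: eq_bigr => k _; rewrite inord_val.
have HE t : -2 < t -> is_derive t 1 H (q.[t] ^+ 2 * K t).
  move=> t2; have : is_derive t 1 H (\sum_(k < p.+1) v 0 k *:
      \sum_(l < p.+1) v 0 l *: (t ^+ (l + k) * K t)).
    apply: is_derive_sum => k; apply: is_deriveZ.
    apply: is_derive_sum => l; apply: is_deriveZ; exact: GE.
  congr (is_derive _ _ _ _); rewrite expr2 {1}qE mulr_suml mulr_suml.
  apply: eq_bigr => k _; rewrite qE /GRing.scale/= -!mulrA; congr (_ * _).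
  rewrite mulr_suml mulr_sumr; apply: eq_bigr => l _; rewrite exprD; ring.
have H0 : H 1 - H (-1) = 0.
  rewrite /H !fct_sumE -sumrB big1// => k _.
  have /rowP/(_ k) := vS0; rewrite !mxE => vS0k.
  rewrite -[RHS](mulr0 (v 0 k)) -[in RHS]vS0k /= -mulrBr; congr (_ * _).
  rewrite !fct_sumE -sumrB; apply: eq_bigr => l _.
  by rewrite -mulrBr mxE muE.
have Hmono s t : -1 <= s -> s <= t -> H s <= H t.
  move=> s1; rewrite le_eqVlt => /predU1P[-> //|st].
  have [|c cst E] := @mean_value R H (fun r => q.[r] ^+ 2 * K r) s t st.
    by move=> r /andP[sr _]; apply: HE; lra.
  by rewrite -subr_ge0 E mulr_ge0 ?subr_ge0 ?(ltW st)// mulr_ge0 ?sqr_ge0 ?kernel_ge0.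
have [L _ [_ Ksupp]] := kernel_lipschitz.
(* [H] is nondecreasing on [-1, 1] with equal end values, hence constant; its derivative vanishes at
   some point inside, where K > 0 leaves only q = 0. *)
have zero s t : s < t -> (forall r, s <= r <= t -> 0 < K r) -> exists2 r, s < r < t & root q r.
  move=> st Kst.
  have inK r : s <= r <= t -> -1 <= r <= 1.
    move=> /Kst; apply: contraTT; rewrite -ler_norml -ltNge => r1.
    by rewrite Ksupp// ltxx.
  have /andP[s1 _] : -1 <= s <= 1 by apply: inK; rewrite lexx ltW.
  have /andP[_ t1] : -1 <= t <= 1 by apply: inK; rewrite lexx ltW.
  have Hs1 : H (-1) <= H s by exact: Hmono.
  have Ht1 : H t <= H 1 by apply: Hmono => //; lra.
  have [|c cst E] := @mean_value R H (fun r => q.[r] ^+ 2 * K r) s t st.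
    by move=> r /andP[sr _]; apply: HE; lra.
  exists c => //.
  have Hst : H s <= H t by apply: Hmono => //; exact: ltW.
  have : q.[c] ^+ 2 * K c * (t - s) = 0 by rewrite -E; lra.
  move=> /eqP; rewrite !mulf_eq0 orbb [K c == 0]gt_eqF ?orbF; last first.
    by apply: Kst; rewrite !ltW; case/andP: cst.
  by rewrite orbC subr_eq0 gt_eqF.
have [u [e [e0 Ke]]] := ex_kernel_gt0.
(* Cutting the interval of positivity into p + 1 cells yields p + 1 distinct roots, too many for
   degree at most p. *)
have step_gt0 : 0 < e / p.+1%:R by rewrite divr_gt0.
pose node (i : nat) := u + i%:R * (e / p.+1%:R).
have ex_root (i : nat) : exists r, (i < p.+1)%N -> node i < r < node i.+1 /\ root q r.
  have [ip|ip] := ltnP i p.+1; last by exists 0.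
  have [|r nr|r nr qr] := zero (node i) (node i.+1).
  - by rewrite /node ltrD2l ltr_pM2r// ltr_nat.
  - apply: Ke; have i0 : 0 <= i%:R * (e / p.+1%:R) by rewrite mulr_ge0// ltW.
    have i1 : i.+1%:R * (e / p.+1%:R) <= e.
      by rewrite mulrCA ger_pMr// ler_pdivrMr ?mul1r ?ler_nat.
    move: nr => /andP[]; rewrite /node => r1 r2.
    by rewrite (le_trans _ r1) ?lerDl// (le_trans r2)// lerD2l.
  - by exists r.
have [r rE] := choice ex_root.
have q0 : q = 0.
  apply: (@roots_geq_poly_eq0 _ _ [seq r i | i <- iota 0 p.+1]).
  - apply/allP => y /mapP[i]; rewrite mem_iota add0n => /= ip ->.
    by have [] := rE i ip.
  - rewrite map_inj_in_uniq ?iota_uniq// => i j; rewrite !mem_iota !add0n /= => ip jp rij.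
    have lt_r i' j' : (i' < j')%N -> (j' < p.+1)%N -> r i' < r j'.
      move=> ij jp'; have [/andP[_ r1] _] := rE i' (ltn_trans ij jp').
      have [/andP[r2 _] _] := rE j' jp'.
      rewrite (lt_le_trans r1)// (le_trans _ (ltW r2))// lerD2l ler_wpM2r ?ler_nat//.
      exact: ltW.
    by case: (ltngtP i j) => // [/lt_r|/lt_r] => [/(_ jp)|/(_ ip)]; rewrite rij ltxx.
  - by rewrite size_map size_iota size_poly.
case/negP: v0; apply/eqP/rowP => k; rewrite mxE.
have := coef_poly p.+1 (fun k => v 0 (inord k)) k.
by rewrite -/q q0 coef0 ltn_ord inord_val => <-.
Qed.

(** The conditions on h, x and 1 - x put [-1, 1] strictly inside the rescaled design. The mesh is 1
    / ((N - 1) h) whereas the moment divides by N h: this mismatch costs |mu_k| / (N h), and the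
    Riemann error at most 4 L / (N h). *)
Lemma empirical_moment_error k x : exists2 C, 0 <= C &
  forall (N : nat) (h : R) (X : 'I_N -> R), 0 < h <= 1 -> 2 <= N%:R * h ->
    h < x -> h < 1 - x -> (forall j : 'I_N, X j = j%:R / (N%:R - 1)) ->
    `|empirical_moment K h x X k - kernel_moment K k| <= C / (N%:R * h).
Proof.
have [L L0 gL] := kernel_power_lipschitz k.
pose m := kernel_moment K k.
exists (8 * L + `|m|); first by rewrite addr_ge0// mulr_ge0.
move=> [|n] h X /andP[h0 h1]; first by rewrite mul0r; lra.
move=> Nh hx hx1 XE.
have nh : 1 <= n%:R * h by move: Nh; rewrite -natr1; lra.
have n0 : 0 < n%:R :> R by rewrite -(pmulr_lgt0 _ h0); lra.
have nh0 : 0 < n%:R * h by rewrite mulr_gt0.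
have N0 : 0 < n.+1%:R :> R by [].
have Nh0 : 0 < n.+1%:R * h by rewrite mulr_gt0.
pose d := (n%:R * h)^-1.
have d0 : 0 < d by rewrite invr_gt0.
have d1 : d <= 1 by rewrite invf_le1.
have lastE : - x / h + n%:R * d = (1 - x) / h.
  by rewrite /d; field; rewrite !gt_eqF.
pose s := d * \sum_(j < n) (fun u => u ^+ k * K u) (- x / h + j%:R * d).
have sm : `|s - m| <= L * d * (2 + 2 * d).
  apply: riemann_sum => //.
    by rewrite mulNr ltrN2 ltr_pdivlMr ?mul1r.
  by rewrite lastE ltr_pdivlMr; lra.
have uE (j : 'I_n.+1) : rescaled h x X j = - x / h + j%:R * d.
  rewrite /rescaled XE -natr1 addrK /d; field.
  by rewrite !gt_eqF.
(* N points bound only N - 1 cells; the surplus last point is rescaled to (1 - x) / h > 1, where K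
   vanishes. *)
have last0 : rescaled h x X ord_max ^+ k * K (rescaled h x X ord_max) = 0.
  apply: (gL.2); rewrite uE /= lastE gtr0_norm ?divr_gt0//; last by lra.
  by rewrite ltr_pdivlMr; lra.
have Es : empirical_moment K h x X k = n%:R / n.+1%:R * s.
  rewrite /empirical_moment big_ord_recr /= last0 addr0 /s mulrA; congr (_ * _).
    by rewrite /d; field; rewrite !gt_eqF.
  by apply: eq_bigr => j _; rewrite uE.
have -> : empirical_moment K h x X k - kernel_moment K k =
    n%:R / n.+1%:R * (s - m) - n.+1%:R^-1 * m.
  by rewrite Es /m -natr1; field; rewrite natr1 gt_eqF.
rewrite (le_trans (ler_normB _ _))// mulrDl lerD//.
  rewrite normrM ger0_norm ?divr_ge0//.
  apply: (@le_trans _ _ (n%:R / n.+1%:R * (4 * L * d))).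
    rewrite ler_wpM2l ?divr_ge0// (le_trans sm)//.
    by have := mulr_ge0 L0 (ltW d0); nra.
  have -> : n%:R / n.+1%:R * (4 * L * d) = 4 * L / (n.+1%:R * h).
    by rewrite /d; field; rewrite !gt_eqF.
  by rewrite ler_wpM2r ?invr_ge0 ?(ltW Nh0)//; lra.
rewrite normrM ger0_norm// mulrC ler_wpM2l// lef_pV2 ?posrE//.
by rewrite ger_pMr.
Qed.

End kernel_assumption.
End kernel.

(** * Taylor expansion in two variables *)

Section taylor.
Context {R : realType}.
Implicit Types (f P : R -> R) (g : R -> R -> R) (a r s t u y z e C : R).

(** The mean value theorem for u -> f (a + u) - P u. In the Taylor expansions it turns an error e
    r^q on the derivative into e r^(q + 1) on the function. *)
Lemma derive_increment_bound f (f' : R -> R) P (P' : R -> R) a r t C : `|t| <= r ->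
  (forall u, `|u| <= r -> is_derive (a + u) 1 f (f' u)) ->
  (forall u, is_derive u 1 P (P' u)) ->
  (forall u, `|u| <= r -> `|f' u - P' u| <= C) ->
  `|f (a + t) - f a - (P t - P 0)| <= C * r.
Proof.
move=> tr fE PE fPC.
have C0 : 0 <= C.
  by rewrite (le_trans (normr_ge0 _) (fPC 0 _))// normr0 (le_trans _ tr).
pose phi u := f (a + u) - P u.
have phiE u : `|u| <= r -> is_derive u 1 phi (f' u - P' u).
  move=> ur; have shiftE : is_derive u 1 (fun u => a + u) 1.
    have := is_deriveD (is_derive_cst a u 1) (is_derive_id u 1).
    by rewrite add0r.
  have fu := fE u ur.
  have := is_deriveB (is_derive1_comp fu shiftE) (PE u).
  by rewrite mulr1.
have -> : f (a + t) - f a - (P t - P 0) = phi t - phi 0.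
  by rewrite /phi addr0; lra.
have [t0|t0|->] := ltgtP t 0; last first.
- by rewrite subrr normr0 mulr_ge0// (le_trans _ tr).
- have inr u : 0 <= u <= t -> `|u| <= r.
    by move=> /andP[u0 ut]; rewrite ger0_norm// (le_trans ut)// (le_trans (ler_norm _) tr).
  have [u /inr/phiE//|c /andP[c0 ct] ->] := @mean_value R phi (fun u => f' u - P' u) _ _ t0.
  by rewrite subr0 normrM ler_pM// fPC// inr// !ltW.
- have inr u : t <= u <= 0 -> `|u| <= r.
    move=> /andP[ut u0]; rewrite ler0_norm// (le_trans _ tr)// -normrN.
    by rewrite (le_trans _ (ler_norm _))// lerN2.
  have [u /inr/phiE//|c /andP[c0 ct] E] := @mean_value R phi (fun u => f' u - P' u) _ _ t0.
  rewrite distrC E sub0r normrM normrN ler_pM// fPC// inr// !ltW//.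
Qed.

(** With this normalisation differentiation lowers the index without any factor. *)
Definition divided_power (j : nat) t : R := t ^+ j / j`!%:R.

Lemma divided_power0 t : divided_power 0 t = 1.
Proof. by rewrite /divided_power expr0 fact0 divr1. Qed.

Lemma divided_powerS0 j : divided_power j.+1 0 = 0.
Proof. by rewrite /divided_power expr0n mul0r. Qed.

Lemma is_derive_divided_power j t :
  is_derive t 1 (divided_power j.+1) (divided_power j t).
Proof.
have -> : divided_power j.+1 = j.+1`!%:R^-1 \*: ((id : R -> R) ^+ j.+1).
  by apply/funext => u; rewrite /divided_power exprfctE /= /GRing.scale/= mulrC.
apply: is_derive_eq; rewrite /divided_power /GRing.scale/= mulr1 factS natrM; field.
by rewrite nat1r !pnatr_eq0 -lt0n fact_gt0.
Qed.

Lemma is_derive_sum_divided_power n (A : nat -> R) t :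
  is_derive t 1 (fun u => \sum_(j < n) divided_power j.+1 u * A j)
    (\sum_(j < n) divided_power j t * A j).
Proof.
have -> : (fun u => \sum_(j < n) divided_power j.+1 u * A j) =
    \sum_(j < n) A j \*: divided_power j.+1.
  apply/funext => u; rewrite fct_sumE; apply: eq_bigr => j _.
  by rewrite /= /GRing.scale/= mulrC.
have dE j := is_deriveZ (A j) (is_derive_divided_power j t).
apply: is_derive_eq; apply: eq_bigr => j _; exact: mulrC.
Qed.

(** Order zero in the second variable is essential here: [pderiv] differentiates in that variable
    first, so an earlier derivative in the first variable merges only in this case. *)
Lemma pderiv10 i g y z : pderiv i 0 (pderiv 1 0 g) y z = pderiv i.+1 0 g y z.
Proof. by rewrite /pderiv /derive1n iterSr. Qed.

Lemma pderiv01 i j g y z : pderiv i j (pderiv 0 1 g) y z = pderiv i j.+1 g y z.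
Proof.
by rewrite /pderiv; congr derive1n; apply/funext => s; rewrite /derive1n iterSr.
Qed.

Definition taylor_poly q (c : nat -> nat -> R) s t : R :=
  \sum_(j < q.+1) divided_power j t * \sum_(i < (q - j).+1) divided_power i s * c i j.

Definition jet g y z (i j : nat) : R := pderiv i j g y z.

Lemma taylor_polyS q g y z s t :
  taylor_poly q.+1 (jet g y z) s t =
  (g y z + \sum_(i < q.+1) divided_power i.+1 s * pderiv i 0 (pderiv 1 0 g) y z) +
  \sum_(j < q.+1) divided_power j.+1 t *
    \sum_(i < (q - j).+1) divided_power i s * pderiv i j (pderiv 0 1 g) y z.
Proof.
rewrite /taylor_poly /jet big_ord_recl divided_power0 mul1r subn0; congr (_ + _).
  rewrite big_ord_recl divided_power0 mul1r; congr (_ + _).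
  by apply: eq_bigr => i _; rewrite pderiv10.
apply: eq_bigr => j _; rewrite subSS; congr (_ * _).
by apply: eq_bigr => i _; rewrite pderiv01.
Qed.

Lemma near_pairP (y z : R) (Q : R * R -> Prop) : (\forall v \near (y, z), Q v) ->
  exists2 delta : R, 0 < delta & forall s t, `|s| < delta -> `|t| < delta -> Q (y + s, z + t).
Proof.
move=> /nbhs_ballP[delta /= d0 Qd]; exists delta => // s t sd td.
by apply: Qd; split; rewrite /ball/= opprD addNKr normrN.
Qed.

Lemma continuously_derivable_at_near q g y z e : continuously_derivable_at q g (y, z) ->
  0 < e -> exists2 delta : R, 0 < delta & forall s t, `|s| < delta -> `|t| < delta ->
    `|g (y + s) (z + t) - g y z| <= e.
Proof.
move=> gq e0; have : {for (y, z), continuous (fun v : R * R => g v.1 v.2)}.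
  by case: q gq => [|q] [].
move=> /cvgrPdist_le /(_ e e0) /near_pairP[delta d0 dE].
by exists delta => // s t sd td; rewrite distrC; exact: dE.
Qed.

(** The radius [r] is kept apart from [s] so that the induction hypothesis applies, with the same
    bound, at all intermediate points. *)
Lemma taylor1 q g y z e : continuously_derivable_at q g (y, z) -> 0 < e ->
  exists2 delta : R, 0 < delta & forall r s, r < delta -> `|s| <= r ->
    `|g (y + s) z - \sum_(i < q.+1) divided_power i s * pderiv i 0 g y z| <= e * r ^+ q.
Proof.
elim: q g e => [|q IH] g e gq e0.
  have [delta d0 dE] := continuously_derivable_at_near gq e0.
  exists delta => // r s rd sr; rewrite big_ord1 divided_power0 mul1r mulr1.
  by have := dE s 0; rewrite addr0; apply; rewrite ?normr0// (le_lt_trans sr).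
have [_ [dg g10 _]] := gq.
have [d1 d10 dE] := IH _ _ g10 e0.
have [d2 d20 dgE] := near_pairP dg.
exists (Num.min d1 d2); first by rewrite lt_min d10.
move=> r s; rewrite lt_min => /andP[rd1 rd2] sr.
rewrite big_ord_recl divided_power0 mul1r exprSr mulrA.
under eq_bigr do rewrite -pderiv10.
pose P u := \sum_(i < q.+1) divided_power i.+1 u * pderiv i 0 (pderiv 1 0 g) y z.
have P0 : P 0 = 0 by apply: big1 => i _; rewrite divided_powerS0 mul0r.
rewrite (_ : pderiv (@ord0 q.+1) 0 g y z = g y z)// opprD addrA.
rewrite -[X in _ - X]subr0 -[X in _ - (_ - X)]P0.
apply: (@derive_increment_bound (g ^~ z) (fun u => pderiv 1 0 g (y + u) z) P
  (fun u => \sum_(i < q.+1) divided_power i u * pderiv i 0 (pderiv 1 0 g) y z)) => //.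
- move=> u ur; have := dgE u 0 (le_lt_trans ur rd2).
  by rewrite normr0 addr0 => /(_ d20)[/= /derivableP + _]; rewrite -derive1E.
- by move=> u; exact: (is_derive_sum_divided_power q.+1 (fun i => pderiv i 0 (pderiv 1 0 g) y z)).
- by move=> u ur; exact: dE.
Qed.

(* Expanding first in the second variable and then in the first one on the line through
   the center only involves the derivatives pderiv i j, so no exchange of the order of
   differentiation is needed. *)
Lemma taylor2 q g y z e : continuously_derivable_at q g (y, z) -> 0 < e ->
  exists2 delta : R, 0 < delta & forall r s t, r < delta -> `|s| <= r -> `|t| <= r ->
    `|g (y + s) (z + t) - taylor_poly q (jet g y z) s t| <= e * r ^+ q.
Proof.
elim: q g e => [|q IH] g e gq e0.
  have [delta d0 dE] := continuously_derivable_at_near gq e0.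
  exists delta => // r s t rd sr tr.
  rewrite /taylor_poly /jet !big_ord1 !divided_power0 !mul1r mulr1.
  by apply: dE; rewrite (le_lt_trans _ rd).
have [_ [dg _ g01]] := gq.
have e20 : 0 < e / 2 by rewrite divr_gt0.
have [d1 d10 dE] := IH _ _ g01 e20.
have [d2 d20 dgE] := near_pairP dg.
have [d3 d30 tE] := taylor1 gq e20.
exists (Num.min d1 (Num.min d2 d3)); first by rewrite !lt_min d10 d20.
move=> r s t; rewrite !lt_min => /and3P[rd1 rd2 rd3] sr tr.
pose A j := \sum_(i < (q - j).+1) divided_power i s * pderiv i j (pderiv 0 1 g) y z.
pose P u := \sum_(j < q.+1) divided_power j.+1 u * A j.
have P0 : P 0 = 0 by apply: big1 => i _; rewrite divided_powerS0 mul0r.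
have inc : `|g (y + s) (z + t) - g (y + s) z - (P t - P 0)| <= e / 2 * r ^+ q * r.
  apply: (@derive_increment_bound (g (y + s)) (fun u => pderiv 0 1 g (y + s) (z + u)) P
    (fun u => \sum_(j < q.+1) divided_power j u * A j)) => //.
  - move=> u ur; have [_] := dgE s u (le_lt_trans sr rd2) (le_lt_trans ur rd2).
    by move=> /= /derivableP; rewrite -derive1E.
  - by move=> u; exact: is_derive_sum_divided_power.
  - by move=> u ur; exact: dE.
have tay := tE r s rd3 sr.
rewrite taylor_polyS -/(P t).
move: tay; rewrite big_ord_recl divided_power0 mul1r.
under eq_bigr do rewrite -pderiv10.
rewrite (_ : pderiv (@ord0 q.+1) 0 g y z = g y z)// => tay.
rewrite -(subrKA (g (y + s) z)) (_ : _ - _ + _ =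
  (g (y + s) (z + t) - g (y + s) z - (P t - P 0)) +
  (g (y + s) z - (g y z +
    \sum_(i < q.+1) divided_power i.+1 s * pderiv i 0 (pderiv 1 0 g) y z))); last first.
  by rewrite P0; ring.
rewrite (le_trans (ler_normD _ _))// (le_trans (lerD inc tay))// exprSr.
by rewrite !mulrA -mulrDl -mulrDl -splitr.
Qed.

End taylor.

(** * Symmetry of the Taylor coefficients at a point of the diagonal *)

Section taylor_poly_identities.
Context {R : realType}.
Variable c : nat -> nat -> R.
Local Notation T q := (taylor_poly q c).

(** The difference removes the constant, and adding the value at -r removes the linear terms. *)
Lemma taylor_poly_axes r : T 2 r 0 - T 2 0 r + (T 2 (- r) 0 - T 2 0 (- r)) =
  (c 2%N 0%N - c 0%N 2%N) * r ^+ 2.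
Proof.
by rewrite /taylor_poly !big_ord_recr !big_ord0 /divided_power /= !factS fact0; field.
Qed.

Lemma taylor_poly_odd s t : T 4 s t - T 4 (- s) t - T 4 s (- t) + T 4 (- s) (- t) =
  4 * (c 1%N 1%N * (s * t) + 6^-1 * (c 1%N 3%N * (s * t ^+ 3) + c 3%N 1%N * (s ^+ 3 * t))).
Proof.
by rewrite /taylor_poly !big_ord_recr !big_ord0 /divided_power /= !factS fact0; field.
Qed.

(** The symmetric monomial s t cancels, and s t^3 - s^3 t = 6 r^4 at (r, 2 r) absorbs the factor 1 /
    6; points with s = t could not separate the two quartic terms. *)
Lemma taylor_poly_odd_swap r : (T 4 r (2 * r) - T 4 (2 * r) r) -
    (T 4 (- r) (2 * r) - T 4 (2 * r) (- r)) -
    (T 4 r (- (2 * r)) - T 4 (- (2 * r)) r) +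
    (T 4 (- r) (- (2 * r)) - T 4 (- (2 * r)) (- r)) =
  4 * ((c 1%N 3%N - c 3%N 1%N) * r ^+ 4).
Proof.
have := taylor_poly_odd r (2 * r); have := taylor_poly_odd (2 * r) r.
set c1 := c 1%N 3%N; set c3 := c 3%N 1%N; set c0 := c 1%N 1%N => E1 E2.
transitivity (4 * (c0 * (r * (2 * r)) + 6^-1 * (c1 * (r * (2 * r) ^+ 3) + c3 * (r ^+ 3 * (2 * r))))
  - 4 * (c0 * (2 * r * r) + 6^-1 * (c1 * (2 * r * r ^+ 3) + c3 * ((2 * r) ^+ 3 * r)))).
  by rewrite -E1 -E2; ring.
by field.
Qed.

End taylor_poly_identities.

Section symmetric_taylor.
Context {R : realType}.
Variables (g : R -> R -> R) (x : R).
Hypothesis g_sym : exists2 delta : R, 0 < delta &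
  forall s t, `|s| < delta -> `|t| < delta -> g (x + s) (x + t) = g (x + t) (x + s).
Local Notation T q := (taylor_poly q (jet g x x)).

Lemma small_eq0 (c C : R) : 0 <= C -> (forall e, 0 < e -> `|c| <= e * C) -> c = 0.
Proof.
move=> C0 cC; apply/eqP; rewrite -normr_le0; apply/ler_addgt0Pr => e e0.
rewrite add0r (le_trans (cC (e / (C + 1)) _)) ?divr_gt0 ?ltr_wpDl//.
by rewrite -mulrA ger_pMr// mulrC ler_pdivrMr ?ltr_wpDl// mul1r lerDl.
Qed.

(** T(s, t) and T(t, s) approximate the same value of g; the constant 2 * 2^q accounts for two
    errors at radius 2 r. *)
Let antisym q e : continuously_derivable_at q g (x, x) -> 0 < e ->
  exists2 r : R, 0 < r & forall s t, `|s| <= 2 * r -> `|t| <= 2 * r ->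
    `|T q s t - T q t s| <= e * r ^+ q.
Proof.
move=> gq e0; have [d1 d10 symE] := g_sym.
have e20 : 0 < e / (2 * 2 ^+ q) by rewrite divr_gt0// mulr_gt0// exprn_gt0.
have [d2 d20 tE] := taylor2 gq e20.
exists (Num.min d1 d2 / 4); first by rewrite divr_gt0// lt_min d10.
set r := Num.min d1 d2 / 4 => s t sr tr.
have r0 : 0 < r by rewrite divr_gt0// lt_min d10.
have /andP[rd1 rd2] : (2 * r < d1) && (2 * r < d2).
  by rewrite -lt_min {1}/r; have : 0 < Num.min d1 d2 by [rewrite lt_min d10]; lra.
have st := tE (2 * r) s t rd2 sr tr; have ts := tE (2 * r) t s rd2 tr sr.
have -> : T q s t - T q t s = (g (x + t) (x + s) - T q t s) - (g (x + s) (x + t) - T q s t).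
  by rewrite (symE s t) ?(le_lt_trans _ rd1)//; ring.
rewrite (le_trans (ler_normB _ _))// (le_trans (lerD ts st))// exprMn le_eqVlt.
apply/orP; left; apply/eqP; field.
by rewrite expf_neq0.
Qed.

Lemma pderiv_sym2 : continuously_derivable_at 2 g (x, x) ->
  pderiv 2 0 g x x = pderiv 0 2 g x x.
Proof.
move=> g2; apply/eqP; rewrite -subr_eq0; apply/eqP.
apply: (@small_eq0 _ 2) => // e e0; have [r r0 rE] := antisym g2 e0.
have r1 : `|r| <= 2 * r by rewrite gtr0_norm//; lra.
have r1' : `|- r| <= 2 * r by rewrite normrN.
have z0 : `|0 : R| <= 2 * r by rewrite normr0; lra.
have := ler_normD (T 2 r 0 - T 2 0 r) (T 2 (- r) 0 - T 2 0 (- r)).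
have -> : T 2 r 0 - T 2 0 r + (T 2 (- r) 0 - T 2 0 (- r)) =
    (pderiv 2 0 g x x - pderiv 0 2 g x x) * r ^+ 2.
  rewrite -[pderiv 2 0 g x x]/(jet g x x 2%N 0%N) -[pderiv 0 2 g x x]/(jet g x x 0%N 2%N).
  exact: taylor_poly_axes.
move=> le1; have {le1} := le_trans le1 (lerD (rE _ _ r1 z0) (rE _ _ r1' z0)).
by rewrite normrM (gtr0_norm (exprn_gt0 2 r0)) -mulrDl ler_pM2r ?exprn_gt0//; lra.
Qed.

(* The part of the Taylor polynomial that is odd in both variables, evaluated at
   (r, 2 r) and (2 r, r), isolates the coefficients of s t^3 and s^3 t. *)
Lemma pderiv_sym4 : continuously_derivable_at 4 g (x, x) ->
  pderiv 3 1 g x x = pderiv 1 3 g x x.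
Proof.
move=> g4; apply/esym/eqP; rewrite -subr_eq0; apply/eqP.
apply: (@small_eq0 _ 1) => // e e0; have [r r0 rE] := antisym g4 e0.
have r1 : `|r| <= 2 * r by rewrite gtr0_norm//; lra.
have r1' : `|- r| <= 2 * r by rewrite normrN.
have r2 : `|2 * r| <= 2 * r by rewrite gtr0_norm//; lra.
have r2' : `|- (2 * r)| <= 2 * r by rewrite normrN.
have E : (T 4 r (2 * r) - T 4 (2 * r) r) - (T 4 (- r) (2 * r) - T 4 (2 * r) (- r))
  - (T 4 r (- (2 * r)) - T 4 (- (2 * r)) r) + (T 4 (- r) (- (2 * r)) - T 4 (- (2 * r)) (- r))
  = 4 * ((pderiv 1 3 g x x - pderiv 3 1 g x x) * r ^+ 4).
  rewrite -[pderiv 3 1 g x x]/(jet g x x 3%N 1%N) -[pderiv 1 3 g x x]/(jet g x x 1%N 3%N).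
  exact: taylor_poly_odd_swap.
have := rE _ _ r1 r2; have := rE _ _ r1' r2; have := rE _ _ r1 r2'; have := rE _ _ r1' r2'.
rewrite !ler_norml => /andP[a1 b1] /andP[a2 b2] /andP[a3 b3] /andP[a4 b4].
have : `|(pderiv 1 3 g x x - pderiv 3 1 g x x) * r ^+ 4| <= e * r ^+ 4.
  by rewrite ler_norml; move: E a1 b1 a2 b2 a3 b3 a4 b4; set d := _ * r ^+ 4; lra.
rewrite normrM (gtr0_norm (exprn_gt0 4 r0)) ler_pM2r ?exprn_gt0// mulr1.
by rewrite -ler_norml.
Qed.

End symmetric_taylor.

Lemma taylor_poly_bilinear {R : realType} q (c : nat -> nat -> R) (h : R) (N : nat)
    (phi u : 'I_N -> R) :
  \sum_j \sum_k phi j * phi k * taylor_poly q c (h * u j) (h * u k) =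
  \sum_(b < q.+1) \sum_(i < (q - b).+1) c i b / (i`!%:R * b`!%:R) * h ^+ (i + b)
    * ((\sum_j phi j * u j ^+ i) * (\sum_k phi k * u k ^+ b)).
Proof.
under eq_bigr => j _.
  under eq_bigr => k _.
    rewrite mulr_sumr; under eq_bigr => b _ do rewrite mulrA mulr_sumr.
    over.
  rewrite exchange_big; under eq_bigr => b _ do rewrite exchange_big.
  over.
rewrite exchange_big; apply: eq_bigr => b _; rewrite exchange_big; apply: eq_bigr => i _.
rewrite mulr_suml mulr_sumr; apply: eq_bigr => j _.
rewrite !mulr_sumr; apply: eq_bigr => k _.
by rewrite /divided_power !exprMn exprD invfM; ring.
Qed.

(** * Asymptotics *)

Lemma cvgr_sum (R : realType) (Z I : Type) (F : set_system Z) {FF : Filter F} (r : seq I)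
    (u_ : I -> Z -> R) (l_ : I -> R) : (forall i, u_ i z @[z --> F] --> l_ i) ->
  \sum_(i <- r) u_ i z @[z --> F] --> \sum_(i <- r) l_ i.
Proof.
move=> ul; elim: r => [|i r IH].
  by rewrite big_nil; under eq_fun do rewrite big_nil; exact: cvg_cst.
by rewrite big_cons; under eq_fun do rewrite big_cons; exact: cvgD.
Qed.

(** * Convergence with a rate *)

Section close_to.
Context {R : realType} {Z : Type} (F : set_system Z) {FF : ProperFilter F}.
Variable a : Z -> R.
Hypotheses (a_neq0 : forall z, a z != 0) (a_cvg0 : a z @[z --> F] --> (0 : R)).
Implicit Types (u v : Z -> R) (l m : R).

(** That is, u = l + o(a); the scale a will be h^q. *)
Definition close_to u l := (u z - l) / a z @[z --> F] --> (0 : R).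

Lemma close_to_cvg u l : close_to u l -> u z @[z --> F] --> l.
Proof.
move=> ul; have : a z * ((u z - l) / a z) + l @[z --> F] --> 0 * 0 + l.
  by apply: cvgD; [exact: cvgM|exact: cvg_cst].
rewrite mul0r add0r; apply: cvg_trans; apply: near_eq_cvg; near=> z.
by rewrite mulrCA divff// mulr1 subrK.
Unshelve. all: by end_near. Qed.

Lemma close_to_cst l : close_to (fun=> l) l.
Proof.
rewrite /close_to; under eq_fun do rewrite subrr mul0r.
exact: cvg_cst.
Qed.

Lemma near_close_to u v l : (\forall z \near F, u z = v z) -> close_to v l -> close_to u l.
Proof.
move=> uv; apply: cvg_trans; apply: near_eq_cvg.
by apply: filterS uv => z ->.
Qed.

Lemma close_toD u v l m : close_to u l -> close_to v m ->
  close_to (fun z => u z + v z) (l + m).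
Proof.
move=> ul vm; rewrite /close_to; under eq_fun do rewrite opprD addrACA mulrDl.
have -> : 0 = 0 + 0 :> R by rewrite addr0.
exact: cvgD.
Qed.

Lemma close_toM u v l m : close_to u l -> close_to v m ->
  close_to (fun z => u z * v z) (l * m).
Proof.
move=> ul vm; have vcvg := close_to_cvg vm.
have : (u z - l) / a z * v z + l * ((v z - m) / a z) @[z --> F] --> 0 * m + l * 0.
  by apply: cvgD; [exact: cvgM|apply: cvgM => //; exact: cvg_cst].
rewrite mul0r mulr0 addr0; apply: cvg_trans; apply: near_eq_cvg.
by apply: nearW => z; ring.
Qed.

Lemma close_to_sum (I : Type) (r : seq I) (u_ : I -> Z -> R) (l_ : I -> R) :
  (forall i, close_to (u_ i) (l_ i)) ->
  close_to (fun z => \sum_(i <- r) u_ i z) (\sum_(i <- r) l_ i).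
Proof.
move=> ul; elim: r => [|i r IH].
  by rewrite big_nil; under eq_fun do rewrite big_nil; exact: close_to_cst.
by rewrite big_cons; under eq_fun do rewrite big_cons; exact: close_toD.
Qed.

Lemma close_to_prod (I : Type) (r : seq I) (u_ : I -> Z -> R) (l_ : I -> R) :
  (forall i, close_to (u_ i) (l_ i)) ->
  close_to (fun z => \prod_(i <- r) u_ i z) (\prod_(i <- r) l_ i).
Proof.
move=> ul; elim: r => [|i r IH].
  by rewrite big_nil; under eq_fun do rewrite big_nil; exact: close_to_cst.
by rewrite big_cons; under eq_fun do rewrite big_cons; exact: close_toM.
Qed.

Lemma close_toV u l : l != 0 -> close_to u l -> close_to (fun z => (u z)^-1) l^-1.
Proof.
move=> l0 ul; have ucvg := close_to_cvg ul.
have : (u z - l) / a z * (- ((u z)^-1 * l^-1)) @[z --> F] --> 0 * (- (l^-1 * l^-1)).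
  apply: cvgM => //; apply: cvgN; apply: cvgM; last exact: cvg_cst.
  exact: cvgV.
rewrite mul0r; apply: cvg_trans; apply: near_eq_cvg; near=> z.
have uz : u z != 0 by near: z; exact: (cvgr_neq0 _ ucvg).
by field; rewrite uz l0 a_neq0.
Unshelve. all: by end_near. Qed.

Lemma close_to_det n (M : Z -> 'M[R]_n) (L : 'M[R]_n) :
  (forall i j, close_to (fun z => M z i j) (L i j)) -> close_to (fun z => \det (M z)) (\det L).
Proof.
move=> ML; apply: close_to_sum => s; apply: close_toM; first exact: close_to_cst.
by apply: close_to_prod => i.
Qed.

Lemma close_to_unitmx n (M : Z -> 'M[R]_n) (L : 'M[R]_n) : L \in unitmx ->
  (forall i j, close_to (fun z => M z i j) (L i j)) -> \forall z \near F, M z \in unitmx.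
Proof.
rewrite unitmxE unitfE => L0 /close_to_det/close_to_cvg/cvgr_neq0 => /(_ L0).
by apply: filterS => z; rewrite unitmxE unitfE.
Qed.

(** Cramer's formula makes the entries of the inverse rational in those of M. It holds only
    eventually, because [invmx] returns a singular matrix unchanged. *)
Lemma close_to_invmx n (M : Z -> 'M[R]_n) (L : 'M[R]_n) : L \in unitmx ->
  (forall i j, close_to (fun z => M z i j) (L i j)) ->
  forall i j, close_to (fun z => invmx (M z) i j) (invmx L i j).
Proof.
move=> Lu ML i j; have Mu := close_to_unitmx Lu ML.
apply: (@near_close_to _ (fun z => (\det (M z))^-1 * \adj (M z) i j)).
  by apply: filterS Mu => z Mz; rewrite /invmx Mz mxE.
rewrite /invmx Lu mxE; apply: close_toM.
  by apply: close_toV; [rewrite -unitfE -unitmxE|exact: close_to_det].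
rewrite mxE; under eq_fun do rewrite mxE /cofactor.
apply: close_toM; first exact: close_to_cst.
apply: close_to_det => k l; rewrite !mxE; under eq_fun do rewrite !mxE.
exact: ML.
Qed.

End close_to.

Section design.
Context {R : realType}.

Lemma uniform_design_points (f : R -> R) (N : nat) (X : 'I_N -> R) :
  (forall t, 0 <= t <= 1 -> f t = 1) -> design_points f X ->
  forall j, 0 <= X j <= 1 /\ X j = j%:R / (N%:R - 1).
Proof.
move=> f1 fX j; have [/andP[X0 X1] <-] := fX j; split; first by rewrite X0.
rewrite (@eq_Rintegral _ _ _ _ _ (cst 1)).
  by rewrite Rintegral_cst//= lebesgue_measure_itv /= lte_fin; case: ltP => //=; lra.
move=> t; rewrite inE /= in_itv /= => /andP[t0 tX].
by rewrite f1// t0 (le_trans tX).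
Qed.

End design.

(** * Parity of the limit coefficients, and the sandwich forms *)

Section sandwich.
Context {R : realType} (p : nat) (K : R -> R).
Hypothesis K_kernel : kernel_assumption K.
Implicit Type nu : 'I_p.+1.

(* theta nu a = e_nu' S^-1 (mu_a, ..., mu_(a+p))'. *)
Definition theta nu (a : nat) : R := \sum_k invmx (mxS p K) nu k * kernel_moment K (k + a).

(** Since odd moments vanish, S is unchanged by conjugation with the signs (-1)^k. The signed row w'
    therefore solves the same system as w, and equals it. *)
Lemma theta_sign nu a : theta nu a = (-1) ^+ (a + nu) * theta nu a.
Proof.
pose w : 'rV[R]_p.+1 := row nu (invmx (mxS p K)).
pose w' : 'rV[R]_p.+1 := \row_k ((-1) ^+ (k + nu) * w 0 k).
have wS : w *m mxS p K = delta_mx 0 nu by rewrite -row_mul mulVmx ?mxS_unit// row1.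
have w'S : w' *m mxS p K = delta_mx 0 nu.
  apply/rowP => l; rewrite !mxE eqxx /=.
  have /rowP/(_ l) := wS; rewrite !mxE eqxx /= => wSl.
  transitivity ((-1) ^+ (l + nu) * (l == nu)%:R : R).
    rewrite -wSl mulr_sumr; apply: eq_bigr => k _; rewrite !mxE.
    rewrite [in LHS](kernel_moment_sign K_kernel) !exprD.
    by rewrite -[RHS]mul1r -[X in _ = X * _](sqrr_sign R k); ring.
  have [->|_] := eqVneq l nu; last by rewrite mulr0.
  by rewrite addnn -mul2n exprM sqrrN expr1n expr1n mul1r.
have w'E k : w 0 k = (-1) ^+ (k + nu) * w 0 k.
  have /rowP/(_ k) : w = w' by apply: (can_inj (mulmxK (mxS_unit K_kernel p))); rewrite wS.
  by rewrite [w' 0 k]mxE.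
have thetaE : theta nu a = \sum_k w 0 k * kernel_moment K (k + a).
  by apply: eq_bigr => k _; rewrite /w mxE.
rewrite thetaE mulr_sumr; apply: eq_bigr => k _.
rewrite {1}w'E [in LHS](kernel_moment_sign K_kernel) !exprD.
by rewrite -[RHS]mul1r -[X in _ = X * _](sqrr_sign R k); ring.
Qed.

Lemma theta_odd nu a : odd (a + nu) -> theta nu a = 0.
Proof.
by move=> odda; have := theta_sign nu a; rewrite -signr_odd odda; lra.
Qed.

Lemma sandwich_sum (A : 'M[R]_p.+1) nu :
  sandwich K A nu = \sum_k \sum_l invmx (mxS p K) nu k * invmx (mxS p K) nu l * A k l.
Proof.
have symS k l : invmx (mxS p K) k l = invmx (mxS p K) l k.
  have trS : (mxS p K)^T = mxS p K by apply/matrixP => i j; rewrite !mxE addnC.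
  by rewrite -[in LHS]trS -trmx_inv mxE.
rewrite /sandwich /basis_vector trmx_delta -rowE -colE mxE mxE [RHS]exchange_big.
apply: eq_bigr => l _; rewrite mxE mulr_suml; apply: eq_bigr => k _.
by rewrite mxE (symS l nu); ring.
Qed.

(** A triple (c, a, b) in [r] encodes the rank one term c mu_(k+a) mu_(l+b). *)
Lemma sandwich_theta (A : 'M[R]_p.+1) nu (r : seq (R * nat * nat)) :
  (forall k l, A k l =
     \sum_(c <- r) c.1.1 * (kernel_moment K (k + c.1.2) * kernel_moment K (l + c.2))) ->
  sandwich K A nu = \sum_(c <- r) c.1.1 * (theta nu c.1.2 * theta nu c.2).
Proof.
move=> AE; rewrite sandwich_sum.
rewrite [RHS](eq_bigr (fun c => \sum_k \sum_l invmx (mxS p K) nu k * invmx (mxS p K) nu l *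
    (c.1.1 * (kernel_moment K (k + c.1.2) * kernel_moment K (l + c.2))))); last first.
  move=> c _; rewrite /theta mulr_suml mulr_sumr; apply: eq_bigr => k _.
  by rewrite !mulr_sumr; apply: eq_bigr => l _; ring.
rewrite [RHS]exchange_big; apply: eq_bigr => k _; rewrite [RHS]exchange_big; apply: eq_bigr => l _.
by rewrite AE mulr_sumr.
Qed.

End sandwich.

#[local] Instance joint_oo_proper : ProperFilter joint_oo.
Proof. exact: filter_prod_proper. Qed.

(** * Expansion of the double sum in the effective weights *)

Section asymptotics.
Context {R : realType} (p : nat) (nu : 'I_p.+1) (x : R) (K : R -> R) (g : R -> R -> R)
  (X : forall N : nat, 'I_N -> R) (h : nat -> nat -> R) (q : nat).
Hypotheses (x01 : 0 < x < 1) (K_kernel : kernel_assumption K)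
  (X_uniform : forall N, (1 < N)%N -> forall j : 'I_N, X j = j%:R / (N%:R - 1))
  (h_gt0 : forall n N, 0 < h n N)
  (h_cvg0 : h z.1 z.2 @[z --> joint_oo] --> 0)
  (Nh_cvgy : z.2%:R * h z.1 z.2 ^+ q.+1 @[z --> joint_oo] --> +oo).

Local Notation hh z := (h z.1 z.2).
Local Notation scale := (fun z : nat * nat => hh z ^+ q).
Local Notation u_ z := (rescaled (hh z) x (@X z.2)).

Let h_ge0 n N : 0 <= h n N. Proof. exact: ltW. Qed.

Let scale_neq0 z : scale z != 0.
Proof. by rewrite expf_neq0 ?gt_eqF. Qed.

Let hX_cvg k : hh z ^+ k @[z --> joint_oo] --> (0 : R) ^+ k.
Proof. exact: (cvg_comp _ _ h_cvg0 (@exprn_continuous R k 0)). Qed.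

Hypothesis q_gt0 : (0 < q)%N.

Let scale_cvg0 : scale z @[z --> joint_oo] --> (0 : R).
Proof. by have := @hX_cvg q; rewrite expr0n eqn0Ngt q_gt0. Qed.

Lemma near_regular : \forall z \near joint_oo,
  [/\ (0 < z.1)%N, (1 < z.2)%N, hh z <= 1, hh z < x & hh z < 1 - x] /\ 2 <= z.2%:R * hh z.
Proof.
have /andP[x0 x1] := x01.
near=> z.
have h1 : hh z <= 1 by near: z; apply: (cvgr_le _ h_cvg0).
split; last first.
  apply: (@le_trans _ _ (z.2%:R * hh z ^+ q.+1)).
    by near: z; move/cvgryPge : Nh_cvgy; apply.
  by rewrite ler_wpM2l// exprS ger_pMr// exprn_ile1// ltW.
split => //.
- near: z; exists ([set n | (0 < n)%N], setT) => /=; last by move=> [a b] [].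
  by split; [exact: nbhs_infty_gt|exact: filterT].
- near: z; exists (setT, [set n | (1 < n)%N]) => /=; last by move=> [a b] [].
  by split; [exact: filterT|exact: nbhs_infty_gt].
- near: z; apply: (cvgr_lt _ h_cvg0) => //.
- near: z; apply: (cvgr_lt _ h_cvg0) => //; lra.
Unshelve. all: by end_near. Qed.

(** The error C / (N h), divided by h^q, is C / (N h^(q+1)): this is where the growth of N h^(q+1)
    turns into the rate. *)
Lemma empirical_moment_close k :
  close_to joint_oo scale (fun z => empirical_moment K (hh z) x (@X z.2) k) (kernel_moment K k).
Proof.
have [C C0 CE] := empirical_moment_error K_kernel k x.
apply/cvgr0Pnorm_le => e e0; near=> z.
have [[_ N1 h1 hx hx1] Nh] : [/\ (0 < z.1)%N, (1 < z.2)%N, hh z <= 1, hh z < x &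
  hh z < 1 - x] /\ 2 <= z.2%:R * hh z by near: z; exact: near_regular.
have := CE _ (hh z) (@X z.2) _ Nh hx hx1 (X_uniform N1).
rewrite h_gt0 h1 => /(_ isT) m_err.
have big : C / e <= z.2%:R * hh z ^+ q.+1 by near: z; move/cvgryPge : Nh_cvgy; apply.
rewrite normrM normfV [X in _ / X]ger0_norm ?exprn_ge0 ?h_ge0//.
rewrite ler_pdivrMr ?exprn_gt0// (le_trans m_err)//.
rewrite ler_pdivrMr; last by lra.
move: big; rewrite ler_pdivrMr// exprS => /le_trans; apply.
by rewrite le_eqVlt; apply/orP; left; apply/eqP; ring.
Unshelve. all: by end_near. Qed.

Local Notation M_ z := (empirical_mx p K (hh z) x (@X z.2)).
Local Notation phi_ z := (effective_weight K (hh z) x (@X z.2) nu).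

Let M_close i j : close_to joint_oo scale (fun z => M_ z i j) (mxS p K i j).
Proof.
rewrite mxE; rewrite (_ : (fun z => M_ z i j) =
  fun z => empirical_moment K (hh z) x (@X z.2) (i + j)); last by apply/funext => z; rewrite mxE.
exact: empirical_moment_close.
Qed.

Lemma near_empirical_mx_unit : \forall z \near joint_oo, M_ z \in unitmx.
Proof. by apply: (close_to_unitmx scale_neq0 scale_cvg0) M_close; exact: mxS_unit. Qed.

Let weight_moment k z : R :=
  (z.2%:R * hh z)^-1 * \sum_j phi_ z j * u_ z j ^+ k.

Let weight_momentE k z :
  weight_moment k z = \sum_i invmx (M_ z) nu i * empirical_moment K (hh z) x (@X z.2) (i + k).
Proof.
rewrite /weight_moment /effective_weight /empirical_moment.
under eq_bigr => j _.
  rewrite mulr_sumr mulr_suml.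
  rewrite (eq_bigr (fun i : 'I_p.+1 =>
    invmx (M_ z) nu i * (u_ z j ^+ (i + k) * K (u_ z j)))); last first.
    by move=> i _; rewrite exprD; ring.
  over.
rewrite exchange_big mulr_sumr; apply: eq_bigr => i _.
by rewrite -mulr_sumr mulrCA.
Qed.

Let invM_close i : close_to joint_oo scale (fun z => invmx (M_ z) nu i) (invmx (mxS p K) nu i).
Proof. by apply: (close_to_invmx scale_neq0 scale_cvg0) M_close _ _; exact: mxS_unit. Qed.

Let weight_moment_close k : close_to joint_oo scale (weight_moment k) (theta K nu k).
Proof.
apply: (near_close_to (nearW _ (weight_momentE k))).
apply: close_to_sum => i; apply: close_toM => //.
exact: empirical_moment_close.
Qed.

(** The weights may change sign, and the Taylor remainder admits no cancellation: it is controlled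
    by their absolute mass. On the support |u| <= 1, so m_0 times the l1 norm of w is a bound. *)
Let weight_norm_bounded : exists2 B, 0 <= B &
  \forall z \near joint_oo, (z.2%:R * hh z)^-1 * \sum_j `|phi_ z j| <= B.
Proof.
pose b z := \sum_i `|invmx (M_ z) nu i| * empirical_moment K (hh z) x (@X z.2) 0.
pose B := \sum_i `|invmx (mxS p K) nu i| * kernel_moment K 0.
have bB : b z @[z --> joint_oo] --> B.
  apply: (@cvgr_sum _ _ _ _ _ _ (fun i z => `|invmx (M_ z) nu i| *
    empirical_moment K (hh z) x (@X z.2) 0)) => i; apply: cvgM.
    by apply: cvg_norm; exact: (close_to_cvg scale_neq0 scale_cvg0 (invM_close i)).
  exact: (close_to_cvg scale_neq0 scale_cvg0 (empirical_moment_close 0)).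
exists (`|B| + 1); first by rewrite addr_ge0.
near=> z; have Nh0 : 0 <= (z.2%:R * hh z)^-1 by rewrite invr_ge0 mulr_ge0 ?h_ge0.
apply: (@le_trans _ _ (b z)); last first.
  by near: z; apply: (cvgr_le _ bB); rewrite (le_lt_trans (ler_norm _))// ltrDl.
rewrite /b -mulr_suml [leRHS]mulrC /empirical_moment -mulrA ler_wpM2l// mulr_suml.
apply: ler_sum => j _; rewrite expr0 mul1r /effective_weight normrM ger0_norm ?kernel_ge0//.
have [Ku|Ku] := eqVneq (K (u_ z j)) 0; first by rewrite Ku !mul0r.
rewrite ler_wpM2l ?kernel_ge0// (le_trans (ler_norm_sum _ _ _))//.
apply: ler_sum => i _; rewrite normrM ler_piMr// normrX exprn_ile1//.
have [L _ [_ Ksupp]] := kernel_lipschitz K_kernel.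
by rewrite leNgt; apply: contraNN Ku => /Ksupp ->.
Unshelve. all: by end_near. Qed.

Let taylor_theta z : R := \sum_(b < q.+1) \sum_(i < (q - b).+1)
  jet g x x i b / (i`!%:R * b`!%:R) * hh z ^+ (i + b) * (theta K nu i * theta K nu b).

Let quadratic_form z : R :=
  (z.2%:R * hh z)^-1 ^+ 2 * \sum_j \sum_k phi_ z j * phi_ z k * g (@X z.2 j) (@X z.2 k).

Let taylor_form z : R :=
  (z.2%:R * hh z)^-1 ^+ 2 * \sum_j \sum_k phi_ z j * phi_ z k *
    taylor_poly q (jet g x x) (hh z * u_ z j) (hh z * u_ z k).

(** The term i = b = 0 has no power of h in front, so the full rate of [weight_moment] is used
    there. *)
Let taylor_form_cvg : (taylor_form z - taylor_theta z) / scale z @[z --> joint_oo] --> (0 : R).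
Proof.
pose c i b : R := jet g x x i b / (i`!%:R * b`!%:R).
have : \sum_(b < q.+1) \sum_(i < (q - b).+1) c i b * hh z ^+ (i + b) *
    ((weight_moment i z * weight_moment b z - theta K nu i * theta K nu b) / scale z)
    @[z --> joint_oo] --> \sum_(b < q.+1) \sum_(i < (q - b).+1) c i b * 0 ^+ (i + b) * (0 : R).
  apply: (@cvgr_sum _ _ _ _ _ _ (fun (b : 'I_q.+1) z =>
    \sum_(i < (q - b).+1) c i b * hh z ^+ (i + b) *
    ((weight_moment i z * weight_moment b z - theta K nu i * theta K nu b) / scale z))) => b.
  apply: (@cvgr_sum _ _ _ _ _ _ (fun (i : 'I_(q - b).+1) z => c i b * hh z ^+ (i + b) *
    ((weight_moment i z * weight_moment b z - theta K nu i * theta K nu b) / scale z))) => i.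
  apply: cvgM.
    by apply: cvgM; [exact: cvg_cst|exact: hX_cvg].
  exact: (close_toM scale_neq0 scale_cvg0 (weight_moment_close i) (weight_moment_close b)).
rewrite [X in _ --> X]big1 => [|b _]; last by rewrite big1// => i _; rewrite mulr0.
apply: cvg_trans; apply: near_eq_cvg; apply: nearW => z.
rewrite /taylor_form taylor_poly_bilinear /taylor_theta mulr_sumr -sumrB mulr_suml.
apply: eq_bigr => b _; rewrite mulr_sumr -sumrB mulr_suml; apply: eq_bigr => i _.
by rewrite /weight_moment -/(c i b); ring.
Qed.

Hypothesis g_smooth : continuously_derivable_at q g (x, x).

Let quadratic_form_cvg :
  (quadratic_form z - taylor_form z) / scale z @[z --> joint_oo] --> (0 : R).
Proof.
have [B B0 phiB] := weight_norm_bounded.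
apply/cvgr0Pnorm_le => e e0.
have e1 : 0 < e / (B ^+ 2 + 1) by rewrite divr_gt0// ltr_wpDl// sqr_ge0.
have [delta d0 dE] := taylor2 g_smooth e1.
near=> z.
have hd : hh z < delta by near: z; exact: (cvgr_lt _ h_cvg0).
have phiBz : (z.2%:R * hh z)^-1 * \sum_j `|phi_ z j| <= B by near: z.
have hz := h_gt0 z.1 z.2.
rewrite normrM normfV [X in _ / X]ger0_norm ?exprn_ge0 ?h_ge0//.
rewrite ler_pdivrMr ?exprn_gt0//.
rewrite /quadratic_form /taylor_form -mulrBr -sumrB normrM.
rewrite ger0_norm ?exprn_ge0 ?invr_ge0 ?mulr_ge0 ?h_ge0//.
have [L _ [_ Ksupp]] := kernel_lipschitz K_kernel.
have term j k : `|phi_ z j * phi_ z k * g (@X z.2 j) (@X z.2 k) -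
    phi_ z j * phi_ z k * taylor_poly q (jet g x x) (hh z * u_ z j) (hh z * u_ z k)|
    <= `|phi_ z j| * `|phi_ z k| * (e / (B ^+ 2 + 1) * hh z ^+ q).
  have [->|phij] := eqVneq (phi_ z j) 0; first by rewrite !mul0r subrr normr0 !mul0r.
  have [->|phik] := eqVneq (phi_ z k) 0; first by rewrite mulr0 !mul0r subrr normr0 mulr0 mul0r.
  (* A nonzero weight forces |u| <= 1, so the Taylor bound is used at radius h. *)
  have inside i : phi_ z i != 0 -> `|hh z * u_ z i| <= hh z.
    move=> phii; rewrite normrM gtr0_norm// ger_pMr// leNgt.
    by apply: contraNN phii => /Ksupp Ku; rewrite /effective_weight Ku mul0r.
  have XE i : @X z.2 i = x + hh z * u_ z i.
    by rewrite /rescaled mulrCA divff ?gt_eqF// mulr1 subrKC.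
  rewrite -mulrBr normrM (normrM (phi_ z j)) ler_wpM2l ?mulr_ge0// !XE.
  by apply: dE => //; exact: inside.
apply: (@le_trans _ _ ((z.2%:R * hh z)^-1 ^+ 2 *
    \sum_j \sum_k `|phi_ z j| * `|phi_ z k| * (e / (B ^+ 2 + 1) * hh z ^+ q))).
  rewrite ler_wpM2l ?exprn_ge0 ?invr_ge0 ?mulr_ge0 ?h_ge0//.
  rewrite (le_trans (ler_norm_sum _ _ _))//; apply: ler_sum => j _.
  rewrite -sumrB (le_trans (ler_norm_sum _ _ _))//; apply: ler_sum => k _.
  exact: term.
have -> : (z.2%:R * hh z)^-1 ^+ 2 *
    \sum_j \sum_k `|phi_ z j| * `|phi_ z k| * (e / (B ^+ 2 + 1) * hh z ^+ q) =
    ((z.2%:R * hh z)^-1 * \sum_j `|phi_ z j|) ^+ 2 * (e / (B ^+ 2 + 1) * hh z ^+ q).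
  under eq_bigr do rewrite -mulr_suml -mulr_sumr.
  rewrite -!mulr_suml exprMn. by rewrite !mulrA expr2.
apply: (@le_trans _ _ (B ^+ 2 * (e / (B ^+ 2 + 1) * hh z ^+ q))).
  have side : 0 <= e / (B ^+ 2 + 1) * hh z ^+ q.
    by apply: mulr_ge0; [exact: ltW|rewrite exprn_ge0 ?h_ge0].
  rewrite ler_wpM2r// ler_pXn2r// nnegrE mulr_ge0 ?sumr_ge0//.
  by rewrite invr_ge0 mulr_ge0 ?h_ge0.
rewrite mulrA ler_wpM2r ?exprn_ge0 ?h_ge0// mulrCA ger_pMr// ler_pdivrMr ?mul1r ?lerDl//.
by rewrite ltr_wpDl// sqr_ge0.
Unshelve. all: by end_near. Qed.

Lemma quadratic_form_expansion :
  ((z.2%:R * hh z)^-1 ^+ 2 * \sum_j \sum_k phi_ z j * phi_ z k * g (@X z.2 j) (@X z.2 k) -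
   \sum_(b < q.+1) \sum_(i < (q - b).+1)
     jet g x x i b / (i`!%:R * b`!%:R) * hh z ^+ (i + b) * (theta K nu i * theta K nu b))
  / hh z ^+ q @[z --> joint_oo] --> (0 : R).
Proof.
have : (quadratic_form z - taylor_form z) / scale z + (taylor_form z - taylor_theta z) / scale z
    @[z --> joint_oo] --> 0 + (0 : R) by exact: cvgD.
rewrite addr0; apply: cvg_trans; apply: near_eq_cvg; apply: nearW => z.
by rewrite -mulrDl subrKA.
Qed.

End asymptotics.

(** Integer exponents, because 2 nu - 2 and 2 nu - 4 can be negative. *)
Lemma exprz_double_sub (R : realType) (h : R) (a k : nat) : h != 0 ->
  h ^ (2 * a%:Z - k%:Z) = h ^+ (2 * a) / h ^+ k.
Proof. by move=> h0; rewrite expfzDr// -invr_expz -PoszM. Qed.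

Section moment_expansions.
Context {R : realType}.
Variables (c : nat -> nat -> R) (th : nat -> R) (h : R).
Local Notation expansion q := (\sum_(b < q.+1) \sum_(i < (q - b).+1)
  c i b / (i`!%:R * b`!%:R) * h ^+ (i + b) * (th i * th b)).

Lemma expansion_even : th 1%N = 0 -> c 2%N 0%N = c 0%N 2%N ->
  expansion 2 = c 0%N 0%N * (th 0%N * th 0%N) + h ^+ 2 * (c 0%N 2%N * (th 0%N * th 2%N)).
Proof.
move=> th1 csym.
by rewrite !big_ord_recr !big_ord0 /= !factS fact0 th1 csym; field.
Qed.

(** Only the index pairs (1, 1), (1, 3) and (3, 1) survive; the last two have equal coefficients,
    whence 2 / (1! 3!) = 1 / 3. *)
Lemma expansion_odd : th 0%N = 0 -> th 2%N = 0 -> th 4%N = 0 -> c 3%N 1%N = c 1%N 3%N ->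
  expansion 4 = h ^+ 2 * (c 1%N 1%N * (th 1%N * th 1%N)) +
    h ^+ 4 * (c 1%N 3%N * (3^-1 * (th 1%N * th 3%N))).
Proof.
move=> th0 th2 th4 csym.
by rewrite !big_ord_recr !big_ord0 /= !factS fact0 th0 th2 th4 csym; field.
Qed.

End moment_expansions.

Section sandwich_matrices.
Context {R : realType} (p : nat) (nu : 'I_p.+1) (K : R -> R).
Hypothesis K_kernel : kernel_assumption K.
Local Notation th := (theta K nu).

Lemma sandwich_mxSstar : sandwich K (mxSstar p K) nu = th 0 * th 0.
Proof.
rewrite (@sandwich_theta _ _ _ _ _ [:: (1, 0%N, 0%N)]) ?big_seq1 ?mul1r// => k l.
by rewrite big_seq1 mxE mul1r !addn0.
Qed.

Lemma sandwich_mxA1 : sandwich K (mxA1 p K) nu = th 0 * th 2.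
Proof.
rewrite (@sandwich_theta _ _ _ _ _ [:: (2^-1, 0%N, 2%N); (2^-1, 2%N, 0%N)]).
  by rewrite big_cons big_seq1 /=; field.
by move=> k l; rewrite big_cons big_seq1 mxE /= !addn0 mulrDr.
Qed.

Lemma sandwich_mxA2 : sandwich K (mxA2 p K) nu = th 1 * th 1.
Proof.
rewrite (@sandwich_theta _ _ _ _ _ [:: (1, 1%N, 1%N)]) ?big_seq1 ?mul1r// => k l.
by rewrite big_seq1 mxE mul1r.
Qed.

Lemma sandwich_mxA3 : sandwich K (mxA3 p K) nu = 3^-1 * (th 1 * th 3).
Proof.
rewrite (@sandwich_theta _ _ _ _ _ [:: (6^-1, 3%N, 1%N); (6^-1, 1%N, 3%N)]).
  by rewrite big_cons big_seq1 /=; field.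
by move=> k l; rewrite big_cons big_seq1 mxE /= mulrDr.
Qed.

End sandwich_matrices.

(** * The exact variance and the final assembly *)

Section local_polynomial_variance.
Context (R : realType) (d : measure_display) (T : measurableType d) (P : probability T R)
  (p : nat) (nu : 'I_p.+1) (x : R) (K m : R -> R) (rho : R -> R -> R)
  (eps : nat -> R -> {RV P >-> R}).
Hypotheses (errors : iid_errors eps rho) (K_ge0 : forall u, 0 <= K u).

Lemma variance_local_poly_estimator (n N : nat) (h : R) (X : 'I_N -> R) :
  (0 < n)%N -> (0 < N)%N -> 0 < h -> (forall j, 0 <= X j <= 1) ->
  empirical_mx p K h x X \in unitmx ->
  'V_P[fun w => local_poly_estimator nu K h x X
         (mean_observation n X m (fun i t => eps i t w))] =
  (nu`!%:R ^+ 2 / (n%:R * h ^+ (2 * nu)) * ((N%:R * h)^-1 ^+ 2 *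
    \sum_j \sum_k effective_weight K h x X nu j * effective_weight K h x X nu k *
      rho (X j) (X k)))%:E.
Proof.
move=> n0 N0 h0 X01 Mu.
pose phi := effective_weight K h x X nu.
pose b j : R := nu`!%:R * (h ^- nu * (N%:R * h)^-1) * phi j.
have n_neq0 : n%:R != 0 :> R by rewrite pnatr_eq0 -lt0n.
(* By linearity m contributes a constant, which the variance ignores. *)
have -> : (fun w => local_poly_estimator nu K h x X
         (mean_observation n X m (fun i t => eps i t w))) =
    (fun w => \sum_j b j * m (X j) + \sum_j b j * (n%:R^-1 * \sum_(i < n) eps i (X j) w)).
  apply/funext => w; rewrite local_poly_estimatorE// mulr_sumr -big_split.
  apply: eq_bigr => j _ /=; rewrite /mean_observation /observation big_split /=.
  rewrite sumr_const card_ord -[m _ *+ n]mulr_natl mulrDr mulKf// -/(phi j).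
  by rewrite /b -!mulrA -!mulrDr.
rewrite (variance_weighted_errors errors)//; congr EFin.
rewrite (eq_bigr (fun j => (nu`!%:R * (h ^- nu * (N%:R * h)^-1)) ^+ 2 *
   \sum_k phi j * phi k * rho (X j) (X k))); last first.
  move=> j _; rewrite mulr_sumr; apply: eq_bigr => k _; rewrite /b.
  by set c := nu`!%:R * _; ring.
rewrite -mulr_sumr !mulrA; congr (_ * _).
rewrite mulnC exprM (invfM n%:R) -[(h ^+ nu ^+ 2)^-1]exprVn.
by move: (h ^- nu) (N%:R * h)^-1 => a c; ring.
Qed.

End local_polynomial_variance.

Lemma iid_errors_sym (R : realType) (d : measure_display) (T : measurableType d)
    (P : probability T R) (eps : nat -> R -> {RV P >-> R}) (rho : R -> R -> R) y z :
  iid_errors eps rho -> 0 <= y <= 1 -> 0 <= z <= 1 -> rho y z = rho z y.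
Proof.
case=> _ _ _ E2 y01 z01; apply: EFin_inj; rewrite -!(E2 0%N)//.
by congr expectation; apply/funext => w /=; rewrite mulrC.
Qed.

Theorem theorem2
  (R : realType) (d : measure_display) (T : measurableType d)
  (P : probability T R)
  (p : nat) (nu : 'I_p.+1) (x : R)
  (K f m : R -> R) (rho : R -> R -> R)
  (eps : nat -> R -> {RV P >-> R})
  (X : forall N : nat, 'I_N -> R)
  (h : nat -> nat -> R)
  (hx : 0 < x < 1)
  (errors : iid_errors eps rho)
  (density : sampling_density f)
  (design : forall N : nat, (1 < N)%N -> design_points f (X N))
  (A1 : kernel_assumption K)
  (A2 : bandwidth_assumption nu h)
  (A3 : continuously_derivable_on `[0, 1] (p + 2) m)
  (A4 : forall t, 0 <= t <= 1 -> f t = 1)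
  (A5 : covariance_assumption rho) :
  let mhat := fun (z : nat * nat) (w : T) =>
    local_poly_estimator nu K (h z.1 z.2) x (X z.2)
      (mean_observation z.1 (X z.2) m (fun i t => eps i t w)) in
  let n := fun z : nat * nat => z.1%:R : R in
  let hh := fun z : nat * nat => h z.1 z.2 in
  let nuZ := (nu : nat)%:Z in
  (~~ odd nu ->
   continuously_derivable_at 2 rho (x, x) ->
   z.2%:R * hh z ^+ 3 @[z --> joint_oo] --> +oo ->
   exists2 r : nat * nat -> R,
     r =o_joint_oo (fun z => (n z * hh z ^ (2 * nuZ - 2))^-1) &
     \forall z \near joint_oo,
       ('V_P[mhat z] =
       ((nu`!%:R ^+ 2 * rho x x) / (n z * hh z ^ (2 * nuZ))
          * sandwich K (mxSstar p K) nu
        + (nu`!%:R ^+ 2 * pderiv 0 2 rho x x) / (n z * hh z ^ (2 * nuZ - 2))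
          * sandwich K (mxA1 p K) nu
        + r z)%R%:E)%E)
  /\
  (odd nu ->
   continuously_derivable_at 4 rho (x, x) ->
   z.2%:R * hh z ^+ 5 @[z --> joint_oo] --> +oo ->
   exists2 r : nat * nat -> R,
     r =o_joint_oo (fun z => (n z * hh z ^ (2 * nuZ - 4))^-1) &
     \forall z \near joint_oo,
       ('V_P[mhat z] =
       ((nu`!%:R ^+ 2 * pderiv 1 1 rho x x) / (n z * hh z ^ (2 * nuZ - 2))
          * sandwich K (mxA2 p K) nu
        + (nu`!%:R ^+ 2 * pderiv 1 3 rho x x) / (n z * hh z ^ (2 * nuZ - 4))
          * sandwich K (mxA3 p K) nu
        + r z)%R%:E)%E).
Proof.
move=> mhat n hh nuZ.
have [h_gt0 h_cvg0 _ _] := A2.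
have X_design N (N1 : (1 < N)%N) := uniform_design_points A4 (design N N1).
have rho_sym : exists2 delta : R, 0 < delta &
    forall s t, `|s| < delta -> `|t| < delta -> rho (x + s) (x + t) = rho (x + t) (x + s).
  (* This radius keeps both arguments in [0, 1], where rho is the covariance of the errors. *)
  have /andP[x0 x1] := hx; exists (Num.min x (1 - x)); first by rewrite lt_min x0; lra.
  move=> s t; rewrite !lt_min => /andP[s0 s1] /andP[t0 t1].
  apply: (iid_errors_sym errors).
    by move: s0 s1; rewrite !ltr_norml => /andP[? ?] /andP[? ?]; apply/andP; split; lra.
  by move: t0 t1; rewrite !ltr_norml => /andP[? ?] /andP[? ?]; apply/andP; split; lra.
pose quad z : R := (z.2%:R * hh z)^-1 ^+ 2 * \sum_j \sum_k
  effective_weight K (hh z) x (@X z.2) nu j * effective_weight K (hh z) x (@X z.2) nu k *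
  rho (@X z.2 j) (@X z.2 k).
pose tay q z : R := \sum_(b < q.+1) \sum_(i < (q - b).+1)
  jet rho x x i b / (i`!%:R * b`!%:R) * hh z ^+ (i + b) * (theta K nu i * theta K nu b).
(* Both parities are instances, with q = 2 and q = 4; [main] is compared with the Taylor sum only
   for n > 0, where division by n is legitimate. *)
have expansion q (k : int) (main : nat * nat -> R) : k = 2 * nuZ - q%:Z ->
    (0 < q)%N -> continuously_derivable_at q rho (x, x) ->
    z.2%:R * hh z ^+ q.+1 @[z --> joint_oo] --> +oo ->
    (forall z, (0 < z.1)%N -> main z = nu`!%:R ^+ 2 / (n z * hh z ^+ (2 * nu)) * tay q z) ->
    exists2 r : nat * nat -> R,
      r =o_joint_oo (fun z => (n z * hh z ^ k)^-1) &
      \forall z \near joint_oo, ('V_P[mhat z] = (main z + r z)%:E)%E.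
  move=> -> q0 rho_q Nh mainE.
  have X_unif N (N1 : (1 < N)%N) j := (X_design N N1 j).2.
  have quad_cvg := quadratic_form_expansion nu hx A1 X_unif h_gt0 h_cvg0 Nh q0 rho_q.
  (* The prefactor times o(h^q) is o(1 / (n h^(2 nu - q))). *)
  exists (fun z => nu`!%:R ^+ 2 / (n z * hh z ^+ (2 * nu)) * (quad z - tay q z)).
    apply/eqoP => e e0.
    have e1 : 0 < e / nu`!%:R ^+ 2 by rewrite divr_gt0// exprn_gt0// ltr0n fact_gt0.
    move/cvgr0Pnorm_le : quad_cvg => /(_ _ e1); apply: filterS => z /= le_e.
    have h0 : 0 < hh z by exact: h_gt0.
    have n0 : 0 <= n z by rewrite /n.
    have fact0 : 0 < nu`!%:R ^+ 2 :> R by rewrite exprn_gt0// ltr0n fact_gt0.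
    have le_e' : `|quad z - tay q z| <= e / nu`!%:R ^+ 2 * hh z ^+ q.
      rewrite -ler_pdivrMr ?exprn_gt0// -[X in _ / X]ger0_norm ?exprn_ge0 ?(ltW h0)//.
      by rewrite -normfV -normrM.
    have A0 : 0 <= (n z * hh z ^+ (2 * nu))^-1 by rewrite invr_ge0 mulr_ge0 ?exprn_ge0 ?(ltW h0).
    rewrite exprz_double_sub ?gt_eqF// mulrA [(n z * _ / _)^-1]invfM invrK.
    move: (nu`!%:R ^+ 2) fact0 le_e' => c c0.
    move: (n z * hh z ^+ (2 * nu))^-1 A0 => A A0 le_e'.
    rewrite !normrM (gtr0_norm c0) (ger0_norm A0) (ger0_norm (exprn_ge0 q (ltW h0))).
    have := ler_wpM2l (mulr_ge0 (ltW c0) A0) le_e'.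
    move=> /le_trans; apply; rewrite le_eqVlt; apply/orP; left; apply/eqP; field.
    by rewrite gt_eqF.
  near=> z.
  have [[n0 N1 _ _ _] _] : [/\ (0 < z.1)%N, (1 < z.2)%N, hh z <= 1, hh z < x &
    hh z < 1 - x] /\ 2 <= z.2%:R * hh z by near: z; exact: (near_regular hx h_gt0 h_cvg0 Nh).
  rewrite /mhat (variance_local_poly_estimator nu m errors)//; last first.
  - by near: z; exact: (near_empirical_mx_unit p hx A1 X_unif h_gt0 h_cvg0 Nh q0).
  - by move=> j; have [] := X_design _ N1 j.
  - exact: ltnW.
  - exact: kernel_ge0.
  by congr EFin; rewrite mainE// -/(hh z) -/(quad z) -mulrDr subrKC.
split=> [nu_even rho2 Nh3|nu_odd rho4 Nh5].
- apply: (expansion 2%N) => // z z1; have hz : 0 < hh z := h_gt0 _ _.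
  have nz : n z != 0 by rewrite pnatr_eq0 -lt0n.
  rewrite /tay expansion_even; last 2 first.
  + by apply: theta_odd.
  + exact: pderiv_sym2.
  rewrite sandwich_mxSstar// sandwich_mxA1//.
  rewrite (exprz_double_sub nu 2) ?gt_eqF//.
  have -> : hh z ^ (2 * nuZ) = hh z ^+ (2 * nu) by rewrite -PoszM.
  rewrite -[pderiv 0 2 rho x x]/(jet rho x x 0%N 2%N) -[rho x x]/(jet rho x x 0%N 0%N).
  move: (jet rho x x) => c; field.
  by apply/and3P; split; [rewrite expf_neq0 ?gt_eqF|exact: nz|rewrite gt_eqF].
- apply: (expansion 4%N) => // z z1; have hz : 0 < hh z := h_gt0 _ _.
  have nz : n z != 0 by rewrite pnatr_eq0 -lt0n.
  rewrite /tay expansion_odd; last 4 first.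
  + by apply: theta_odd; rewrite // oddD nu_odd.
  + by apply: theta_odd; rewrite // oddD nu_odd.
  + by apply: theta_odd; rewrite // oddD nu_odd.
  + exact: pderiv_sym4.
  rewrite sandwich_mxA2// sandwich_mxA3//.
  rewrite (exprz_double_sub nu 2) ?gt_eqF// (exprz_double_sub nu 4) ?gt_eqF//.
  rewrite -[pderiv 1 1 rho x x]/(jet rho x x 1%N 1%N) -[pderiv 1 3 rho x x]/(jet rho x x 1%N 3%N).
  move: (jet rho x x) => c; field.
  by apply/and3P; split; [rewrite expf_neq0 ?gt_eqF|exact: nz|rewrite gt_eqF].
Unshelve. all: by end_near.
Qed.
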